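(* Let $k\ge 2$ be a fixed integer, let $\alpha>1$ be a fixed irrational number of finite type $\tau<\infty$, and let $\beta$ be a fixed real number. Then for any constant $\varepsilon>0$ and all real $x\ge 1$, $$ \sum_{\substack{1\leq n\leq x\\ [\alpha n+\beta]\in\mathcal{Q}_{k}}}1\;-\;\alpha^{-1}\sum_{\substack{1\leq m\leq [\alpha x+\beta]\\ m\in\mathcal{Q}_{k}}}1\;\ll\; x^{k/(2k-1)+\varepsilon}+x^{1-1/(\tau+1)+\varepsilon}, $$ where $n$ and $m$ run over integers and the implied constant depends only on $\alpha$, $\varepsilon$, $k$ and $\beta$.
   Context: $[t]$ denotes the greatest integer not larger than $t$. $\mathcal{Q}_k$ denotes the set of positive $k$-free integers, i.e. the positive integers $q$ such that for positive integers $m$, $m^k\mid q$ implies $m=1$. $\|t\|$ denotes the distance from the real number $t$ to the nearest integer. The type $\tau$ of an irrational number $\alpha$ is $$\tau:=\sup\Big\{\theta\in\mathbb{R}:\ \liminf_{\substack{q\to\infty\\ q\in\mathbb{Z}^{+}}}q^{\theta}\,\|\alpha q\|=0\Big\},$$ and $\alpha$ is of finite type if $\tau<\infty$. The notation $f\ll g$ means $|f|\le Cg$ for some constant $C>0$ (the implied constant). Empty sums are $0$. *)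

(* Defs.v *)
From mathcomp Require Import all_boot all_order all_algebra.
From mathcomp Require Import all_classical all_reals all_analysis.

Set Implicit Arguments.
Unset Strict Implicit.
Unset Printing Implicit Defensive.

Import Order.TTheory GRing.Theory Num.Theory.

Local Open Scope classical_set_scope.
Local Open Scope ring_scope.

Definition kfree (k : nat) : set int :=
  [set q | 0 < q /\ forall m : int, 0 < m -> (m ^+ k %| q)%Z -> m = 1].

Definition dist_int (R : realType) (t : R) : R :=
  inf [set `|t - m%:~R| | m in [set: int]].

(* The term q = 0 does not affect the limit inferior as q tends to infinity. *)
Definition diophantine_type (R : realType) (alpha : R) : \bar R :=
  ereal_sup [set theta%:E | theta in [set theta : R |
    limn_einf (fun q : nat => (q%:R `^ theta * dist_int (alpha * q%:R))%:E)
      = 0%E]].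

(* For n >= 1, n < (Num.truncn y).+1 means n <= y, equivalently n <= floor y;
   the ranges are empty when y < 1, including when y is negative. *)
Definition beatty_kfree_count (R : realType) (k : nat) (alpha beta x : R) : R :=
  \sum_(1 <= n < (Num.truncn x).+1
        | Num.floor (alpha * n%:R + beta) \in kfree k) 1.

Definition kfree_count (R : realType) (k : nat) (y : R) : R :=
  \sum_(1 <= m < (Num.truncn y).+1 | m%:Z \in kfree k) 1.

(* Main.v *)
Require Import Defs.
From mathcomp Require Import all_boot all_order all_algebra.
From mathcomp Require Import all_classical all_reals all_analysis.
From mathcomp Require Import zify ring lra.

Set Implicit Arguments.
Unset Strict Implicit.
Unset Printing Implicit Defensive.

Import Order.TTheory GRing.Theory Num.Theory.

Local Open Scope classical_set_scope.
Local Open Scope ring_scope.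

(* A positive integer m is a value of the Beatty sequence exactly when an
   integer lies in [(m - beta)/alpha, (m + 1 - beta)/alpha), so the indicator of
   such m is 1/alpha plus a difference of two sawtooth values, and the theorem
   bounds the sum of these differences over k-free m <= M, where M is about
   alpha x.  Moebius inversion reduces this to sums over the multiples of d^k.
   For d > y = M^(1/(2k-1)) the trivial bound M/d^k suffices.

   For d <= y no Fourier analysis is needed: repeated use of Dirichlet's theorem
   cuts a sawtooth sum of length L along a rotation by theta into blocks whose
   lengths are denominators h of good approximations, each block contributing
   O(1), whence the bound sum_{h <= L} min(L, 1/||h theta||)/h up to a constant.
   With theta = d^k/alpha and n = h d^k, the divisor bound turns the sum over d
   and h into sum_{n <= M} min(M, min(y^k, n)/||n/alpha||)/n.  This is estimated
   on blocks of length q, where q is a Dirichlet denominator of 1/alpha at most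
   about M^(t/(t+1)) with t slightly above tau; the type forces q to be at least
   about M^(1/(t+1)). *)

(** * Distance to the nearest integer and Dirichlet's theorem *)

Lemma dist_int_le {R : realType} (t : R) (m : int) :
  dist_int t <= `|t - m%:~R|.
Proof.
apply: ge_inf; last by exists m.
by exists 0 => _ [i _ <-].
Qed.

(** The nearest integer is the floor or the floor plus one: any other integer lies beyond one of
    these two. *)
Lemma dist_int_attained {R : realType} (t : R) :
  exists m : int, dist_int t = `|t - m%:~R|.
Proof.
suff [m Hm] : exists m : int, forall n : int, `|t - m%:~R| <= `|t - n%:~R|.
  exists m; apply/le_anti; rewrite dist_int_le /=.
  by apply: lb_le_inf => [|_ [n _ <-]]; [exists `|t - m%:~R|, m | exact: Hm].
have /andP[f1 f2] := floor_itv t.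
set f := Num.floor t in f1 f2.
have far (n : int) : t - f%:~R <= `|t - n%:~R| \/ f%:~R + 1 - t <= `|t - n%:~R|.
  have [nf|fn] := leP n f; [left|right].
    move: nf; rewrite -(ler_int R) => nf.
    by apply: le_trans (ler_norm _); lra.
  move: fn; rewrite -lezD1 -(ler_int R) => fn.
  by rewrite -normrN; apply: le_trans (ler_norm _); rewrite !rmorphD /= in fn; lra.
rewrite rmorphD /= in f2.
have e1 : `|t - f%:~R| = t - f%:~R by rewrite ger0_norm //; lra.
have e2 : `|t - (f + 1)%:~R| = f%:~R + 1 - t.
  by rewrite rmorphD /= ler0_norm //; lra.
have [c|c] := leP (t - f%:~R) (f%:~R + 1 - t).
  by exists f => n; rewrite e1; have [] := far n; lra.
by exists (f + 1) => n; rewrite e2; have [] := far n; lra.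
Qed.

Lemma dist_int_ge0 {R : realType} (t : R) : 0 <= dist_int t.
Proof. by have [m ->] := dist_int_attained t. Qed.

Lemma dist_intN {R : realType} (t : R) : dist_int (- t) = dist_int t.
Proof.
have le (u : R) : dist_int (- u) <= dist_int u.
  have [m ->] := dist_int_attained u.
  apply: le_trans (dist_int_le _ (- m)) _.
  by rewrite rmorphN /= -opprD normrN.
apply/le_anti/andP; split; first exact: le.
by rewrite -{1}(opprK t) le.
Qed.

(** Pigeonhole: two of the [N + 1] fractional parts of multiples of [theta] share one of [N] cells
    of length 1/N. Coprimality is what later makes a full period visit every residue once. *)
Lemma dirichlet {R : realType} (theta : R) (N : nat) : (0 < N)%N ->
  exists q : nat, exists2 a : int, (0 < q <= N)%N &
    coprimez q a /\ `|theta * q%:R - a%:~R| <= N%:R^-1.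
Proof.
move=> N0.
have N0R : 0 < N%:R :> R by rewrite ltr0n.
pose fr (t : R) := t - (Num.floor t)%:~R.
have fr01 t : 0 <= fr t < 1.
  by have := floor_itv t; rewrite /fr rmorphD /=; lra.
have bd (i : 'I_N.+1) : (Num.truncn (N%:R * fr (theta * i%:R))%R < N)%N.
  have /andP[f0 f1] := fr01 (theta * i%:R).
  rewrite truncn_lt_nat; first by rewrite gtr_pMr.
  by rewrite mulr_ge0 // ltW.
pose f (i : 'I_N.+1) : 'I_N := Ordinal (bd i).
have : ~~ injectiveb f.
  apply/negP => /injectiveP /leq_card; rewrite !card_ord; lia.
move=> /injectivePn[i [j ij /(congr1 val) /= fij]].
wlog lt_ij : i j ij fij / (i < j)%N.
  move=> H; have [/H|ji|/val_inj e] := ltngtP i j; first exact.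
    by apply: (H j i) => //; rewrite eq_sym.
  by rewrite e eqxx in ij.
have [q0 [a0 [q0P a0P]]] : exists q : nat, exists a : int, (0 < q <= N)%N /\
    `|theta * q%:R - a%:~R| <= N%:R^-1.
  exists (j - i)%N, (Num.floor (theta * j%:R) - Num.floor (theta * i%:R)).
  split; first by have := ltn_ord j; lia.
  rewrite natrB 1?ltnW // rmorphB /=.
  have -> : theta * (j%:R - i%:R) - ((Num.floor (theta * j%:R))%:~R -
    (Num.floor (theta * i%:R))%:~R) = fr (theta * j%:R) - fr (theta * i%:R).
    by rewrite /fr; ring.
  have /andP[i0 _] := fr01 (theta * i%:R).
  have /andP[j0 _] := fr01 (theta * j%:R).
  have /truncn_itv /andP[] : 0 <= N%:R * fr (theta * i%:R) by rewrite mulr_ge0 // ltW.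
  have /truncn_itv /andP[] : 0 <= N%:R * fr (theta * j%:R) by rewrite mulr_ge0 // ltW.
  rewrite fij; move: (Num.truncn _) => T.
  rewrite -natr1 => j1 j2 i1 i2.
  rewrite -[X in `|X|](mulKf (lt0r_neq0 N0R)) normrM gtr0_norm ?invr_gt0 //.
  apply: ler_piMr; first by rewrite invr_ge0 ltW.
  rewrite ler_norml mulrBr; lra.
(* Dividing by the gcd shrinks both the denominator and the error. *)
pose g := gcdz q0 a0.
have gN0 : (0 < `|g|)%N.
  by rewrite /g /gcdz /= gcdn_gt0; case/andP: q0P => ->.
have gE : g = `|g|%:Z by [].
have gq : (`|g| %| q0)%N by rewrite /g /gcdz /= dvdn_gcdl.
have ga : (g %| a0)%Z by rewrite dvdz_gcdr.
exists (q0 %/ `|g|)%N, (a0 %/ g)%Z.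
  case/andP: q0P => p1 p2.
  by rewrite divn_gt0 // dvdn_leq //= (leq_trans (leq_div _ _)).
split.
  apply/eqP.
  apply: (@mulIf _ g); first by rewrite -absz_gt0.
  rewrite mul1r.
  have := mulz_gcdl (q0 %/ `|g|)%N (a0 %/ g)%Z g.
  have -> : (q0 %/ `|g|)%N%:Z * g = q0 by rewrite {2}gE -PoszM divnK.
  by rewrite divzK // -/g.
have q0E : q0%:R = (q0 %/ `|g|)%N%:R * `|g|%:R :> R by rewrite -natrM divnK.
have a0E : a0%:~R = (a0 %/ g)%Z%:~R * `|g|%:R :> R.
  by rewrite -{1}(divzK ga) rmorphM /= {2}gE.
have -> : theta * (q0 %/ `|g|)%N%:R - (a0 %/ g)%Z%:~R
   = (theta * q0%:R - a0%:~R) / `|g|%:R.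
  by rewrite q0E a0E; field; rewrite pnatr_eq0 -lt0n.
rewrite normrM normfV (ger0_norm (ler0n _ _)).
apply: le_trans a0P.
by apply: ler_piMr => //; rewrite invf_le1 ?ltr0n // ler1n.
Qed.

(** * Rotations over one period of an approximating fraction *)

(** The shift by 1/2 gives mean zero, so that sums over full periods stay bounded. *)
Definition sawtooth {R : realType} (t : R) : R := t - (Num.floor t)%:~R - 2^-1.

Definition harm (R : realType) (n : nat) : R := \sum_(1 <= i < n.+1) i%:R^-1.

Lemma ler_sum_nat_sub {R : realType} (m n p : nat) (F : nat -> R) :
  (n <= p)%N -> (forall i, 0 <= F i) ->
  \sum_(m <= i < n) F i <= \sum_(m <= i < p) F i.
Proof.
move=> np F0; have [mn|nm] := leqP m n.
  by rewrite (big_cat_nat mn np) //= lerDl sumr_ge0.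
by rewrite big_geq ?sumr_ge0 // ltnW.
Qed.

Lemma harm_ge0 {R : realType} n : 0 <= harm R n.
Proof. by rewrite sumr_ge0 // => i _; rewrite invr_ge0. Qed.

Lemma ler_harm {R : realType} m n : (m <= n)%N -> harm R m <= harm R n.
Proof. by move=> mn; apply: ler_sum_nat_sub => // i; rewrite invr_ge0. Qed.

Lemma sum_nat_delta {R : realType} (n c : nat) :
  \sum_(0 <= r < n) (r == c)%:R = (c < n)%N%:R :> R.
Proof.
elim: n => [|n IH]; first by rewrite big_geq.
rewrite big_nat_recr //= IH ltnS [in RHS]leq_eqVlt eq_sym.
by case: eqVneq => [->|_]; rewrite ?ltnn ?add0r //= addr0.
Qed.

Lemma sum_nat_delta_le1 {R : realType} (n c : nat) :
  \sum_(0 <= r < n) (r == c)%:R <= 1 :> R.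
Proof. by rewrite sum_nat_delta; case: (c < n)%N. Qed.

(** The terms r = 0 and r = 1 vanish, the inverse of 0 being 0. *)
Lemma sum_inv_pred_le {R : realType} (n : nat) :
  \sum_(0 <= r < n) (r.-1)%:R^-1 <= harm R n.
Proof.
have sumE q : \sum_(0 <= r < q.+2) (r.-1)%:R^-1 = harm R q.
  elim: q => [|q IH]; last by rewrite big_nat_recr //= IH [RHS]big_nat_recr.
  by rewrite /harm 2?big_nat_recr //= !big_geq // !invr0 !addr0.
case: n => [|[|n]]; first by rewrite /harm !big_geq.
  by rewrite big_nat1 invr0 harm_ge0.
by rewrite sumE ler_harm // -addn2 leq_addr.
Qed.

Lemma sum_modz_perm {R : realType} (q : nat) (a j : int) (F : nat -> R) :
  (0 < q)%N -> coprimez q a ->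
  \sum_(0 <= i < q) F `|((i%:Z * a + j) %% q)%Z|%N = \sum_(0 <= i < q) F i.
Proof.
move=> q0 cop.
have qN0 : q%:Z != 0 by rewrite -lt0n.
have bd i : (`|((i%:Z * a + j) %% q)%Z| < q)%N.
  by rewrite -ltz_nat gez0_abs ?modz_ge0 // ltz_pmod.
rewrite !big_mkord.
pose h (i : 'I_q) : 'I_q := Ordinal (bd i).
rewrite [RHS](reindex_inj (h := h)) // => x y /(congr1 val) /= e.
have {}e : ((x%:Z * a + j) == (y%:Z * a + j) %[mod q])%Z.
  by rewrite -(gez0_abs (modz_ge0 (x%:Z * a + j) qN0)) e gez0_abs ?modz_ge0.
move: e; rewrite eqz_mod_dvd.
have -> : x%:Z * a + j - (y%:Z * a + j) = (x%:Z - y%:Z) * a by ring.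
rewrite Gauss_dvdzl // dvdzE => /= d; apply/val_inj => /=.
have := ltn_ord x; have := ltn_ord y.
have [] := posnP `|x%:Z - y%:Z|%N; first by lia.
by move=> /dvdn_leq /(_ d); lia.
Qed.

(* One full period of a rotation by an angle close to a / q visits the q
   cells [r/q, (r+1)/q) once each, up to an error smaller than 2/q. *)
Lemma rotation_block {R : realType} (theta u : R) (q : nat) (a : int)
    (G : R -> R) (F : nat -> R) :
  (0 < q)%N -> coprimez q a -> `|theta * q%:R - a%:~R| <= q%:R^-1 ->
  (forall (z : int) (r : nat) (e : R), (r < q)%N -> -1 < e -> e < 2 ->
     G (z%:~R + (r%:R + e) / q%:R) <= F r) ->
  \sum_(0 <= i < q) G (theta * i%:R + u) <= \sum_(0 <= r < q) F r.
Proof.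
move=> q0 cop app bd.
have qR : 0 < q%:R :> R by rewrite ltr0n.
have qN0 : q%:Z != 0 by rewrite -lt0n.
pose j := Num.floor (q%:R * u).
rewrite -(sum_modz_perm j F q0 cop).
apply: ler_sum_nat => i /andP[_ iq].
have /andP[w0 w1] := floor_itv (q%:R * u); rewrite -/j rmorphD /= in w0 w1.
set m := i%:Z * a + j.
have mE : m = (m %/ q)%Z * q%:Z + `|(m %% q)%Z|%N%:Z.
  by rewrite gez0_abs ?modz_ge0 // -divz_eq.
have mR : i%:R * a%:~R + j%:~R = (m %/ q)%Z%:~R * q%:R + `|(m %% q)%Z|%N%:R :> R.
  have := congr1 (fun z : int => z%:~R : R) mE.
  by rewrite /= {1}/m !rmorphD !rmorphM /=.
have rq : (`|(m %% q)%Z| < q)%N by rewrite -ltz_nat gez0_abs ?modz_ge0 // ltz_pmod.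
pose d := theta * q%:R - a%:~R.
have dle : `|i%:R * d| < 1.
  rewrite normrM ger0_norm ?ler0n //.
  have iqR : i%:R < q%:R :> R by rewrite ltr_nat.
  apply: le_lt_trans (_ : i%:R * q%:R^-1 < 1); first by rewrite ler_wpM2l.
  by rewrite ltr_pdivrMr // mul1r.
(* The fractional part of [q%:R * u] lies in [0, 1) and [i%:R * d] in (-1, 1), whence the range of
   [e]. *)
pose e := q%:R * u - j%:~R + i%:R * d.
have -> : theta * i%:R + u = (m %/ q)%Z%:~R + (`|(m %% q)%Z|%N%:R + e) / q%:R.
  apply: (mulIf (lt0r_neq0 qR)); rewrite [RHS]mulrDl mulfVK ?lt0r_neq0 //.
  by rewrite addrA -mR /e /d; ring.
move: dle; rewrite ltr_norml => /andP[d1 d2].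
by apply: bd => //; rewrite /e; lra.
Qed.

Lemma sawtooth_bound {R : realType} (t : R) : -2^-1 <= sawtooth t < 2^-1.
Proof. by have := floor_itv t; rewrite /sawtooth rmorphD /=; lra. Qed.

(** Outside the first and last cell the shift [e] cannot carry the point across an integer, so the
    deviation is e/q. On those two cells it is at most 1 trivially. *)
Lemma sawtooth_near {R : realType} (q r : nat) (z : int) (e : R) :
  (r < q)%N -> -1 < e -> e < 2 ->
  `|sawtooth (z%:~R + (r%:R + e) / q%:R) - (r%:R / q%:R - 2^-1)| <=
    2 / q%:R + (r == 0)%N%:R + (r == q.-1)%N%:R.
Proof.
move=> rq e1 e2.
have q0 : (0 < q)%N by lia.
have qR : 0 < q%:R :> R by rewrite ltr0n.
have qV : 0 < q%:R^-1 :> R by rewrite invr_gt0.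
have qq : q%:R * q%:R^-1 = 1 :> R by rewrite divff // lt0r_neq0.
have [c|c] := boolP ((r == 0)%N || (r == q.-1)).
  have c1 : 1 <= (r == 0)%N%:R + (r == q.-1)%N%:R :> R.
    by case/orP: c => /eqP <-; rewrite eqxx; case: (_ == _)%N; rewrite /=; lra.
  have := sawtooth_bound (z%:~R + (r%:R + e) / q%:R).
  have rq0 : 0 <= r%:R / q%:R :> R by rewrite divr_ge0.
  have rq1 : r%:R / q%:R < 1 :> R by rewrite ltr_pdivrMr // mul1r ltr_nat.
  by move=> ?; rewrite ler_norml; lra.
have r1 : 1 <= r%:R :> R by rewrite ler1n; lia.
have r2 : r%:R + 2 <= q%:R :> R by rewrite -natrD ler_nat; lia.
have fl : Num.floor (z%:~R + (r%:R + e) / q%:R) = z.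
  apply/floor_def; rewrite rmorphD /= lerDl ltrD2l.
  by rewrite ltr_pdivrMr // divr_ge0 //; lra.
rewrite /sawtooth fl.
have -> : z%:~R + (r%:R + e) / q%:R - z%:~R - 2^-1 - (r%:R / q%:R - 2^-1) = e / q%:R.
  by ring.
have h1 : `|e / q%:R| <= 2 / q%:R.
  by rewrite normrM (ger0_norm (ltW qV)) ler_wpM2r ?(ltW qV) // ler_norml; lra.
by apply: le_trans h1 _; rewrite -addrA lerDl addr_ge0.
Qed.

Lemma sum_sawtooth_grid {R : realType} (q : nat) : (0 < q)%N ->
  \sum_(0 <= r < q) (r%:R / q%:R - 2^-1) = - 2^-1 :> R.
Proof.
move=> q0; have qR : q%:R != 0 :> R by rewrite pnatr_eq0 -lt0n.
have s n : \sum_(0 <= r < n) r%:R = n%:R * (n%:R - 1) / 2 :> R.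
  elim: n => [|n IH]; first by rewrite big_geq // !mul0r.
  by rewrite big_nat_recr //= IH -natr1; field.
rewrite big_split /= -mulr_suml s sumr_const_nat subn0 -mulr_natr.
by field.
Qed.

(** The grid values sum to -1/2 and the errors to at most 2 + 1 + 1, so 5 suffices. *)
Lemma sum_sawtooth_block {R : realType} (theta u : R) (q : nat) (a : int) :
  (0 < q)%N -> coprimez q a -> `|theta * q%:R - a%:~R| <= q%:R^-1 ->
  `|\sum_(0 <= i < q) sawtooth (theta * i%:R + u)| <= 5.
Proof.
move=> q0 cop app.
have qR : q%:R != 0 :> R by rewrite pnatr_eq0 -lt0n.
have err : \sum_(0 <= r < q) (2 / q%:R + (r == 0)%N%:R + (r == q.-1)%N%:R) <= 4 :> R.
  rewrite !big_split /= sumr_const_nat subn0.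
  have -> : (2 / q%:R) *+ q = 2 :> R by rewrite -mulr_natr; field.
  have := @sum_nat_delta_le1 R q 0; have := @sum_nat_delta_le1 R q q.-1.
  by lra.
rewrite ler_norml; apply/andP; split.
  rewrite -lerN2 opprK -sumrN.
  have := @rotation_block R theta u q a (fun t => - sawtooth t)
    (fun r => 2 / q%:R + (r == 0)%N%:R + (r == q.-1)%N%:R - (r%:R / q%:R - 2^-1))
    q0 cop app.
  move=> H; apply: le_trans (H _) _ => {H}; last first.
    by rewrite sumrB sum_sawtooth_grid //; lra.
  move=> z r e rq e1 e2; have := sawtooth_near z rq e1 e2.
  by rewrite ler_norml; lra.
have := @rotation_block R theta u q a sawtooth
    (fun r => 2 / q%:R + (r == 0)%N%:R + (r == q.-1)%N%:R + (r%:R / q%:R - 2^-1))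
    q0 cop app.
move=> H; apply: le_trans (H _) _ => {H}; last first.
  by rewrite big_split /= sum_sawtooth_grid //; lra.
move=> z r e rq e1 e2; have := sawtooth_near z rq e1 e2.
by rewrite ler_norml; lra.
Qed.

(** The four cells nearest to an integer get the trivial bound [A]. Any other cell keeps distance at
    least (r - 1)/q or (q - 2 - r)/q, which leads to two harmonic sums. *)
Lemma sum_min_dist_block {R : realType} (theta u A B : R) (q : nat) (a : int) :
  (0 < q)%N -> coprimez q a -> `|theta * q%:R - a%:~R| <= q%:R^-1 ->
  0 <= A -> 0 <= B ->
  \sum_(0 <= i < q) Num.min A (B / dist_int (theta * i%:R + u)) <=
    4 * A + 2 * B * q%:R * harm R q.
Proof.
move=> q0 cop app A0 B0.
have qR : 0 < q%:R :> R by rewrite ltr0n.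
pose F r : R := A * ((r == 0)%N%:R + (r == 1)%N%:R + (r == q.-1)%N%:R + (r == q.-2)%N%:R)
   + B * q%:R * (r.-1%:R^-1 + (q - 2 - r)%N%:R^-1).
have sF : \sum_(0 <= r < q) F r <= 4 * A + 2 * B * q%:R * harm R q.
  rewrite /F big_split /= -!mulr_sumr !big_split /=.
  have rev : \sum_(0 <= r < q) (q - 2 - r)%N%:R^-1 <= harm R q.
    rewrite big_nat_rev /= add0n; apply: le_trans (@sum_inv_pred_le R q).
    apply: ler_sum_nat => r rq.
    by have -> : (q - 2 - (q - r.+1))%N = r.-1 by lia.
  apply: lerD.
    rewrite mulrC ler_wpM2r //.
    have := @sum_nat_delta_le1 R q 0; have := @sum_nat_delta_le1 R q 1.
    have := @sum_nat_delta_le1 R q q.-1; have := @sum_nat_delta_le1 R q q.-2.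
    by lra.
  have -> : 2 * B * q%:R * harm R q = B * q%:R * (harm R q + harm R q) by ring.
  by rewrite ler_wpM2l ?mulr_ge0 ?(ltW qR) // lerD // sum_inv_pred_le.
apply: le_trans sF; apply: (@rotation_block R theta u q a
  (fun t => Num.min A (B / dist_int t)) F q0 cop app) => z r e rq e1 e2.
have P2 : 0 <= B * q%:R * (r.-1%:R^-1 + (q - 2 - r)%N%:R^-1).
  by rewrite !mulr_ge0 ?addr_ge0 ?invr_ge0 // ltW.
have [c|c] := boolP [|| (r == 0)%N, (r == 1)%N, (r == q.-1)%N | (r == q.-2)%N].
  have c1 : 1 <= (r == 0)%N%:R + (r == 1)%N%:R + (r == q.-1)%N%:R + (r == q.-2)%N%:R :> R.
    by move: c; do 4! case: (_ == _)%N; rewrite //= => _; lra.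
  rewrite ge_min /F; apply/orP; left.
  by rewrite -[X in X <= _]addr0 lerD // ler_peMr.
rewrite ge_min /F; apply/orP; right.
apply: le_trans (_ : B * q%:R * (r.-1%:R^-1 + (q - 2 - r)%N%:R^-1) <= _); last first.
  by rewrite lerDr mulr_ge0 // !addr_ge0.
have x1 : 0 < r.-1%:R :> R by rewrite ltr0n; lia.
have x2 : 0 < (q - 2 - r)%N%:R :> R by rewrite ltr0n; lia.
have x1E : r.-1%:R = r%:R - 1 :> R by rewrite -subn1 natrB //; lia.
have x2E : (q - 2 - r)%N%:R = q%:R - 2 - r%:R :> R by rewrite !natrB //; lia.
have qV : 0 < q%:R^-1 :> R by rewrite invr_gt0.
have qq : q%:R * q%:R^-1 = 1 :> R by rewrite divff // lt0r_neq0.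
have fin (x : R) : 0 < x -> x / q%:R <= dist_int (z%:~R + (r%:R + e) / q%:R) ->
    B / dist_int (z%:~R + (r%:R + e) / q%:R) <= B * q%:R * x^-1.
  move=> x0 xd; rewrite -mulrA ler_wpM2l //.
  rewrite -[leRHS]invrK invfM invrK lef_pV2 ?posrE; first by rewrite mulrC.
    by apply: lt_le_trans xd; rewrite divr_gt0.
  by rewrite mulr_gt0.
have V1 : 0 <= B * q%:R * r.-1%:R^-1 by rewrite !mulr_ge0 ?invr_ge0 // ltW.
have V2 : 0 <= B * q%:R * (q - 2 - r)%N%:R^-1 by rewrite !mulr_ge0 ?invr_ge0 // ltW.
rewrite mulrDr.
suff : r.-1%:R / q%:R <= dist_int (z%:~R + (r%:R + e) / q%:R) \/
       (q - 2 - r)%N%:R / q%:R <= dist_int (z%:~R + (r%:R + e) / q%:R).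
  by case=> [/(fin _ x1)|/(fin _ x2)] H; apply: le_trans H _; rewrite ?lerDl ?lerDr.
have [m ->] := dist_int_attained (z%:~R + (r%:R + e) / q%:R).
rewrite x1E x2E.
have [mz|zm] := leP m z; [left|right].
  move: mz; rewrite -(ler_int R) => mz.
  apply: le_trans (ler_norm _); rewrite -addrA addrCA.
  apply: le_trans (_ : (r%:R + e) / q%:R <= _); last by rewrite lerDl subr_ge0.
  by rewrite ler_wpM2r ?(ltW qV) //; lra.
move: zm; rewrite -lezD1 -(ler_int R) rmorphD /= => zm.
rewrite -normrN; apply: le_trans (ler_norm _).
have : (q%:R - 2 - r%:R) / q%:R <= 1 - (r%:R + e) / q%:R.
  have -> : 1 - (r%:R + e) / q%:R = (q%:R - (r%:R + e)) / q%:R by rewrite mulrBl qq.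
  by rewrite ler_wpM2r ?(ltW qV) //; lra.
by lra.
Qed.

(** * Sawtooth sums and sums of reciprocal distances *)

Lemma big_nat_blocks {R : realType} (b q : nat) (f : nat -> R) :
  \sum_(0 <= i < b * q) f i = \sum_(0 <= t < b) \sum_(0 <= i < q) f (t * q + i)%N.
Proof.
elim: b => [|b IH]; first by rewrite mul0n !big_geq.
rewrite big_nat_recr //= -IH (big_cat_nat (n := (b * q)%N)) ?leq_mul //=.
congr (_ + _); rewrite -{1}[(b * q)%N]add0n big_addn mulSn addnK.
by apply: eq_bigr => i _; rewrite addnC.
Qed.

(* The denominators q produced by successive applications of Dirichlet's
   theorem decrease strictly, so each h on the right is charged at most once. *)
Lemma sum_sawtooth_le {R : realType} (theta : R) :
  (forall h, (0 < h)%N -> 0 < dist_int (theta * h%:R)) ->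
  forall (L : nat) (u : R),
  `|\sum_(0 <= i < L) sawtooth (theta * i%:R + u)| <=
    5 * \sum_(1 <= h < L.+1) h%:R^-1 * Num.min L%:R (1 / dist_int (theta * h%:R)).
Proof.
move=> pos; elim/ltn_ind => L IH u.
have [->|L0] := posnP L; first by rewrite !big_geq // normr0 mulr0.
have [q [a /andP[q0 qL] [cop app]]] := dirichlet theta L0.
have LR : 0 < L%:R :> R by rewrite ltr0n.
have qR : 0 < q%:R :> R by rewrite ltr0n.
have appq : `|theta * q%:R - a%:~R| <= q%:R^-1.
  by apply: le_trans app _; rewrite lef_pV2 ?posrE // ler_nat.
pose b := (L %/ q)%N; pose r := (L %% q)%N.
have rq : (r < q)%N by rewrite ltn_mod.
have LE : L = (b * q + r)%N := divn_eq L q.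
have bq : (b * q <= L)%N by rewrite LE leq_addr.
rewrite (big_cat_nat (n := (b * q)%N)) //=.
apply: le_trans (ler_normD _ _) _.
have P1 : `|\sum_(0 <= i < b * q) sawtooth (theta * i%:R + u)| <= 5 * b%:R.
  rewrite big_nat_blocks; apply: le_trans (ler_norm_sum _ _ _) _.
  apply: le_trans (_ : \sum_(0 <= t < b) (5 : R) <= _); last first.
    by rewrite sumr_const_nat subn0 mulr_natr.
  apply: ler_sum => t _.
  rewrite (eq_bigr (fun i => sawtooth (theta * i%:R + (theta * (t * q)%N%:R + u)))).
    exact: sum_sawtooth_block appq.
  by move=> i _; congr sawtooth; rewrite natrD; ring.
have P2 : `|\sum_(b * q <= i < L) sawtooth (theta * i%:R + u)| <=
    5 * \sum_(1 <= h < r.+1) h%:R^-1 * Num.min r%:R (1 / dist_int (theta * h%:R)).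
  rewrite -{1}[(b * q)%N]add0n big_addn.
  have -> : (L - b * q)%N = r by rewrite {1}LE addKn.
  rewrite (eq_bigr (fun i => sawtooth (theta * i%:R + (theta * (b * q)%N%:R + u)))).
    by apply: IH; apply: leq_trans rq qL.
  by move=> i _; congr sawtooth; rewrite natrD; ring.
apply: le_trans (lerD P1 P2) _; rewrite -mulrDr ler_pM2l //.
pose f h : R := h%:R^-1 * Num.min L%:R (1 / dist_int (theta * h%:R)).
have f0 h : 0 <= f h.
  by rewrite mulr_ge0 ?invr_ge0 // le_min ler0n divr_ge0 // dist_int_ge0.
(* The choice of [q] puts [theta * q%:R] within 1/L of an integer, so the minimum at h = q is [L],
   and L/q pays for the [b] blocks. *)
have fb : b%:R <= f q.
  have -> : f q = q%:R^-1 * L%:R.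
    congr (_ * _); apply/min_idPl; rewrite mul1r -[leLHS]invrK.
    rewrite lef_pV2 ?posrE ?invr_gt0 ?pos //.
    exact: le_trans (dist_int_le _ a) app.
  by rewrite mulrC ler_pdivlMr // -natrM ler_nat.
rewrite addrC.
apply: le_trans (_ : \sum_(1 <= h < r.+1) f h + f q <= _).
  apply: lerD fb; apply: ler_sum_nat => h _.
  rewrite ler_wpM2l ?invr_ge0 // le_min ge_min ler_nat ge_min lexx orbT andbT.
  by rewrite (leq_trans (ltnW rq) qL).
apply: le_trans (_ : \sum_(1 <= h < q.+1) f h <= _); last exact: ler_sum_nat_sub.
by rewrite [leRHS]big_nat_recr //= lerD2r; apply: ler_sum_nat_sub.
Qed.

(** The integer n a - m q is nonzero, since q cannot divide n. Replacing a by gamma q changes it by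
    at most n/q <= 1/2, so q |gamma n - m| >= 1/2. *)
Lemma dist_int_lower {R : realType} (gamma : R) (q : nat) (a : int) (n : nat) :
  (0 < q)%N -> coprimez q a -> `|gamma * q%:R - a%:~R| <= q%:R^-1 ->
  (0 < n)%N -> (n.*2 <= q)%N -> (2 * q%:R)^-1 <= dist_int (gamma * n%:R).
Proof.
move=> q0 cop app n0 nq.
have qR : 0 < q%:R :> R by rewrite ltr0n.
have nR : 0 < n%:R :> R by rewrite ltr0n.
have [m ->] := dist_int_attained (gamma * n%:R).
have kN0 : n%:Z * a - m * q%:Z != 0.
  apply/negP; rewrite subr_eq0 => /eqP e.
  have : (q %| n%:Z * a)%Z by rewrite e dvdz_mull.
  by rewrite Gauss_dvdzl // dvdzE => /(dvdn_leq n0) /=; lia.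
have k1 : 1 <= `|n%:R * a%:~R - m%:~R * q%:R| :> R.
  have -> : n%:R * a%:~R - m%:~R * q%:R = (n%:Z * a - m * q%:Z)%:~R :> R.
    by rewrite rmorphB /= !rmorphM.
  by rewrite -intr_norm ler1z; lia.
have E : n%:R * a%:~R - m%:~R * q%:R
   = q%:R * (gamma * n%:R - m%:~R) - n%:R * (gamma * q%:R - a%:~R) by ring.
have T := ler_normB (q%:R * (gamma * n%:R - m%:~R)) (n%:R * (gamma * q%:R - a%:~R)).
rewrite -E !normrM !normr_nat in T.
have h2 : n%:R * `|gamma * q%:R - a%:~R| <= 2^-1.
  apply: le_trans (_ : n%:R * q%:R^-1 <= _); first by rewrite ler_pM2l.
  rewrite ler_pdivrMr // mulrC ler_pdivlMr //.
  by rewrite -natrM ler_nat muln2.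
rewrite invfM -ler_pdivlMr; last by rewrite invr_gt0.
rewrite invrK mulrC.
by lra.
Qed.

(** For n up to q/2 the distances are at least 1/(2q), and the bound [n] in the inner minimum
    cancels [n%:R^-1], leaving one block sum. Larger n are cut into blocks of length q; on block t
    one has 1/n <= 2/(q(t + 1)), and summing over t produces [harm R M]. *)
Lemma sum_reciprocal_dist_le {R : realType} (gamma Y : R) (q M : nat) (a : int) :
  (forall h, (0 < h)%N -> 0 < dist_int (gamma * h%:R)) ->
  (0 < q)%N -> coprimez q a -> `|gamma * q%:R - a%:~R| <= q%:R^-1 ->
  0 <= Y ->
  \sum_(1 <= n < M.+1)
    n%:R^-1 * Num.min M%:R (Num.min Y n%:R / dist_int (gamma * n%:R)) <=
  8 * q%:R + 2 * q%:R * harm R q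
    + harm R M * (8 * (M%:R / q%:R) + 4 * Y * harm R q).
Proof.
move=> pos q0 cop app Y0.
have qR : 0 < q%:R :> R by rewrite ltr0n.
pose s := (q./2).+1.
have sq : (s <= q)%N.
  by rewrite /s; case: q q0 {qR cop app s} => [|[|q]] // _; lia.
pose f n : R := n%:R^-1 * Num.min M%:R (Num.min Y n%:R / dist_int (gamma * n%:R)).
have f0 n : 0 <= f n.
  rewrite mulr_ge0 ?invr_ge0 // le_min ler0n divr_ge0 ?dist_int_ge0 //.
  by rewrite le_min Y0 ler0n.
apply: le_trans (_ : \sum_(1 <= n < s + M * q) f n <= _).
  apply: ler_sum_nat_sub => //.
  by rewrite /s addSn ltnS (leq_trans _ (leq_addl _ _)) // leq_pmulr.
rewrite (big_cat_nat (n := s)) ?leq_addr //=; apply: lerD.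
  apply: le_trans (_ : \sum_(0 <= n < q)
      Num.min (2 * q%:R) (1 / dist_int (gamma * n%:R + 0)) <= _).
    have g0 n : 0 <= Num.min (2 * q%:R) (1 / dist_int (gamma * n%:R + 0)) :> R.
      by rewrite le_min divr_ge0 ?dist_int_ge0 // andbT mulr_ge0 // ltW.
    apply: le_trans (_ : \sum_(1 <= n < q)
      Num.min (2 * q%:R) (1 / dist_int (gamma * n%:R + 0)) <= _); last first.
      by rewrite [leRHS]big_ltn // lerDr.
    apply: le_trans (_ : \sum_(1 <= n < s)
      Num.min (2 * q%:R) (1 / dist_int (gamma * n%:R + 0)) <= _); last first.
      exact: ler_sum_nat_sub.
    apply: ler_sum_nat => n /andP[n0 ns].
    have nR : 0 < n%:R :> R by rewrite ltr0n.
    have dn : (2 * q%:R)^-1 <= dist_int (gamma * n%:R).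
      by apply: dist_int_lower app n0 _ => //; rewrite /s in ns; lia.
    rewrite addr0; apply: le_trans (_ : 1 / dist_int (gamma * n%:R) <= _).
      rewrite [leLHS]mulrC ler_pdivrMr // ge_min; apply/orP; right.
      rewrite mulrAC mul1r ler_wpM2r ?invr_ge0 ?dist_int_ge0 //.
      by rewrite ge_min lexx orbT.
    rewrite le_min lexx andbT mul1r.
    rewrite -[leRHS]invrK lef_pV2 ?posrE ?invr_gt0 ?mulr_gt0 //.
    exact: pos.
  have A0 : 0 <= 2 * q%:R :> R by rewrite mulr_ge0.
  apply: le_trans (sum_min_dist_block 0 q0 cop app A0 ler01) _.
  by rewrite mulrA mulr1 -natrM.
rewrite -{1}[s]add0n big_addn addKn big_nat_blocks.
apply: le_trans (_ : \sum_(0 <= t < M) (t.+1)%:R^-1 *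
    (8 * (M%:R / q%:R) + 4 * Y * harm R q) <= _); last first.
  by rewrite -mulr_suml {2}/harm [\sum_(1 <= i < M.+1) _]big_add1.
apply: ler_sum => t _.
apply: le_trans (_ : \sum_(0 <= i < q) (2 / q%:R * (t.+1)%:R^-1) *
    Num.min M%:R (Y / dist_int (gamma * i%:R + gamma * (t * q + s)%N%:R)) <= _).
  apply: ler_sum_nat => i iq.
  rewrite /f; set n := (t * q + i + s)%N.
  have -> : gamma * i%:R + gamma * (t * q + s)%N%:R = gamma * n%:R.
    by rewrite -mulrDr -natrD; congr (_ * _%:R); rewrite /n; lia.
  apply: ler_pM; rewrite ?invr_ge0 //.
  - rewrite le_min ler0n divr_ge0 ?dist_int_ge0 //.
    by rewrite le_min Y0 ler0n.
  - have -> : 2 / q%:R * (t.+1)%:R^-1 = (q%:R * (t.+1)%:R / 2)^-1 :> R.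
      by rewrite !invfM invrK; ring.
    rewrite lef_pV2 ?posrE ?divr_gt0 ?mulr_gt0 ?ltr0n //; last by rewrite /n /s; lia.
    rewrite ler_pdivrMr // -!natrM ler_nat /n /s.
    have := odd_double_half q; nia.
  rewrite le_min ge_min lexx /= ge_min; apply/orP; right.
  by rewrite ler_wpM2r ?invr_ge0 ?dist_int_ge0 // ge_min lexx.
rewrite -mulr_sumr.
apply: le_trans (_ : 2 / q%:R * (t.+1)%:R^-1 *
  (4 * M%:R + 2 * Y * q%:R * harm R q) <= _).
  rewrite ler_wpM2l; last exact: (sum_min_dist_block _ q0 cop app).
    by [].
  by rewrite mulr_ge0 ?invr_ge0 // divr_ge0.
rewrite [X in X <= _](_ : _ = (t.+1)%:R^-1 *
    (8 * (M%:R / q%:R) + 4 * Y * harm R q)) //.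
by field; rewrite addrC natr1 !pnatr_eq0 -lt0n q0.
Qed.

(** * Moebius inversion, the divisor bound and harmonic sums *)

Lemma big_nat_dvd {V : nmodType} (D M : nat) (F : nat -> V) : (0 < D)%N ->
  \sum_(1 <= n < M.+1 | (D %| n)%N) F n = \sum_(1 <= h < (M %/ D).+1) F (h * D)%N.
Proof.
move=> D0; rewrite big_mkcond /=.
elim: M => [|M IH]; first by rewrite div0n !big_geq.
rewrite big_nat_recr //= IH divnS //.
case: ifP => dv; last by rewrite add0n addr0.
rewrite add1n [RHS]big_nat_recr //=; congr (_ + F _).
by rewrite -[LHS](divnK dv) divnS // dv.
Qed.

Definition moebius (n : nat) : int :=
  \prod_(p <- primes n) (if logn p n == 1%N then - 1 else 0).

Lemma moebius1 : moebius 1 = 1.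
Proof. by rewrite /moebius big_nil. Qed.

Lemma normr_moebius_le1 n : `|moebius n| <= 1.
Proof.
rewrite /moebius; elim: (primes n) => [|p s IH]; first by rewrite big_nil.
rewrite big_cons normrM; case: ifP => _; last by rewrite normr0 mul0r.
by rewrite normrN normr1 mul1r.
Qed.

(** Multiplying by [p] either creates a square factor or adds a new prime; the sign change drives
    the pairing in [sum_moebius_kfree]. *)
Lemma moebius_mulp (p e : nat) : prime p -> (0 < e)%N ->
  moebius (e * p) = if (p %| e)%N then 0 else - moebius e.
Proof.
move=> pp e0; have p0 := prime_gt0 pp.
case: ifP => [pe|/negbT pe].
  have pin : p \in primes (e * p).
    by rewrite mem_primes pp muln_gt0 e0 p0 dvdn_mull.
  rewrite /moebius (bigD1_seq p) ?primes_uniq //=.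
  rewrite lognM // (logn_prime _ pp) eqxx addn1 eqSS.
  by rewrite -[_ == 0%N]negbK -lt0n logn_gt0 mem_primes pp e0 pe mul0r.
have perm : perm_eq (primes (e * p)) (p :: primes e).
  apply: uniq_perm; rewrite ?primes_uniq //= ?primes_uniq ?andbT.
    by rewrite mem_primes pp e0.
  move=> r; rewrite primesM // (primes_prime pp) mem_seq1 in_cons.
  by rewrite orbC.
rewrite /moebius (perm_big _ perm) big_cons /=.
rewrite lognM // (logn_prime _ pp) eqxx lognE pp e0 (negbTE pe) /= mulN1r.
congr (- _); rewrite big_seq [in RHS]big_seq; apply: eq_bigr => r.
rewrite mem_primes => /and3P[pr _ re].
rewrite lognM // (logn_prime _ pp).
by case: (eqVneq r p) => [E|_]; [rewrite -E re in pe | rewrite addn0].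
Qed.

Lemma kfree_natP (k m : nat) : (0 < m)%N ->
  (m%:Z \in kfree k) <-> forall d : nat, (0 < d)%N -> (d ^ k %| m)%N -> d = 1%N.
Proof.
move=> m0; split.
  move/set_mem => [_ H] d d0 dm; suff : d%:Z = 1 by case.
  by apply: H => //; rewrite dvdzE abszX.
move=> H; apply/mem_set; split => //= z z0 zm.
have := H `|z|%N; rewrite absz_gt0 lt0r_neq0 // => /(_ isT).
move: zm; rewrite dvdzE abszX /= => zm /(_ zm); lia.
Qed.

(** For k-free m only d = 1 survives. Otherwise p^k divides m for some prime p, and each e prime to
    p is paired with e p: both satisfy the divisibility or neither does, and their Moebius values
    cancel. *)
Lemma sum_moebius_kfree (k m M : nat) : (0 < k)%N -> (0 < m <= M)%N ->
  \sum_(1 <= d < M.+1 | (d ^ k %| m)%N) moebius d = (m%:Z \in kfree k)%:R.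
Proof.
move=> k0 /andP[m0 mM].
have [kf|nkf] := boolP (m%:Z \in kfree k).
  rewrite big_ltn_cond //; last lia.
  rewrite exp1n dvd1n moebius1 big_nat_cond big1 ?addr0 // => d /andP[/andP[d2 _] dm].
  by have := (kfree_natP k m0).1 kf d (ltnW d2) dm; lia.
have [p pp pm] : exists2 p : nat, prime p & (p ^ k %| m)%N.
  apply: contrapT => nex; move/negP: nkf; apply; apply/(kfree_natP k m0) => d d0 dm.
  apply/eqP; rewrite eqn_leq d0 andbT leqNgt; apply/negP => d1.
  apply: nex; exists (pdiv d); first exact: pdiv_prime.
  by apply: dvdn_trans dm; rewrite dvdn_exp2r // pdiv_dvd.
have p0 := prime_gt0 pp.
have key e : ~~ (p %| e)%N -> ((e * p) ^ k %| m)%N = (e ^ k %| m)%N.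
  move=> pe; rewrite expnMn Gauss_dvd; first by rewrite pm andbT.
  by rewrite coprimeXl // coprimeXr // coprime_sym prime_coprime.
rewrite (bigID (fun d => p %| d)%N) /= addrC.
rewrite [X in _ + X](_ : _ = \sum_(1 <= d < M.+1 | (p %| d)%N)
    (if (d ^ k %| m)%N then moebius d else 0)); last first.
  by rewrite big_mkcond [RHS]big_mkcond; apply: eq_bigr => d _ /=;
     case: (_ ^ _ %| _)%N; case: (p %| d)%N.
rewrite big_nat_dvd //.
rewrite big_mkcond (big_cat_nat (n := (M %/ p).+1)) //=; last first.
  by rewrite ltnS leq_div.
(* An e beyond M/p has no partner in range, but e^k | m would force e p <= (e p)^k <= m <= M. *)
rewrite [X in _ + X + _]big_nat_cond [X in _ + X + _]big1 ?addr0; last first.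
  move=> d /andP[/andP[Md _] _]; case: ifP => // /andP[dm pd].
  have d0 : (0 < d)%N by apply: leq_trans Md.
  move: dm; rewrite -key // => /(dvdn_leq m0) dm.
  have : (d * p <= (d * p) ^ k)%N.
    by rewrite -{1}[(d * p)%N]expn1 leq_pexp2l // muln_gt0 p0 d0.
  move: Md; rewrite ltn_divLR // => Md le_dp.
  by have := leq_ltn_trans (leq_trans le_dp (leq_trans dm mM)) Md; rewrite ltnn.
rewrite -big_split /= big_nat big1 // => e /andP[e0 _].
rewrite moebius_mulp //.
have [pe|pe] := boolP (p %| e)%N.
  by rewrite andbF add0r; case: ifP.
by rewrite key // andbT; case: ifP; rewrite ?addrN // addr0.
Qed.

(** A divisor is determined by its exponent at [p] and its part prime to [p]. *)
Lemma size_divisors_part (p n : nat) : prime p -> (0 < n)%N ->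
  (size (divisors n) <= (logn p n).+1 * size (divisors n`_p^'))%N.
Proof.
move=> pp n0.
rewrite -[X in (X * _)%N](size_iota 0) -(size_allpairs (fun i e => p ^ i * e)%N).
apply: uniq_leq_size; first exact: divisors_uniq.
move=> d; rewrite -dvdn_divisors // => dn.
have d0 : (0 < d)%N := dvdn_gt0 n0 dn.
apply/allpairsP; exists (logn p d, (d`_p^')%N); split.
- by rewrite mem_iota add0n ltnS dvdn_leq_log.
- by rewrite /= -dvdn_divisors ?part_gt0 // partn_dvd.
by rewrite /= -p_part partnC.
Qed.

Lemma bernoulli_inequality {R : realType} (x : R) (a : nat) : 0 <= x ->
  1 + a%:R * x <= (1 + x) ^+ a.
Proof.
move=> x0; elim: a => [|a IH]; first by rewrite mul0r addr0 expr0.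
rewrite exprS; apply: le_trans (_ : (1 + x) * (1 + a%:R * x) <= _).
  have : 0 <= x * (a%:R * x) by rewrite !mulr_ge0.
  by rewrite -natr1; lra.
by rewrite ler_wpM2l // addr_ge0.
Qed.

Lemma powR_natmul {R : realType} (x a : R) (n : nat) : 0 <= x ->
  (x `^ a) ^+ n = x `^ (a * n%:R).
Proof. by move=> x0; rewrite powRrM powR_mulrn ?powR_ge0. Qed.

(* Removing a prime p with exponent a costs a factor a + 1, which is at most
   p^(a eps) once p^eps >= 2; the finitely many smaller primes cost C0 each. *)
Lemma size_divisors_le {R : realType} (eps : R) : 0 < eps ->
  exists2 C : R, 0 < C &
    forall n : nat, (0 < n)%N -> (size (divisors n))%:R <= C * n%:R `^ eps.
Proof.
move=> e0.
pose s : R := 2 `^ eps.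
have s1 : 1 < s.
  have := @gt0_ltr_powR R eps e0 1 2; rewrite powR1; apply; rewrite ?nnegrE //.
  by rewrite (ltr_nat R 1 2).
(* Chosen so that C0 (1 + a (s - 1)) >= a + 1 for every a; Bernoulli's inequality bounds the bracket
   by s^a. *)
pose C0 : R := 1 + (s - 1)^-1.
have sV : 0 < (s - 1)^-1 by rewrite invr_gt0 subr_gt0.
have C01 : 1 <= C0 by rewrite /C0; lra.
pose P0 := (Num.truncn (2 `^ eps^-1 : R)).+1.
have big_p p : (P0 <= p)%N -> 2 <= p%:R `^ eps :> R.
  move=> Pp; have : 2 `^ eps^-1 <= p%:R :> R.
    apply: le_trans (ltW (truncnS_gt _)) _; by rewrite ler_nat.
  move=> /(ge0_ler_powR (ltW e0)); rewrite -powRrM mulVf ?lt0r_neq0 // powRr1 //.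
  by apply; rewrite ?nnegrE ?powR_ge0.
have step p a : prime p -> a.+1%:R <= (if (p < P0)%N then C0 else 1) * (p%:R `^ eps) ^+ a.
  move=> pp.
  have ps : s <= p%:R `^ eps.
    apply: (ge0_ler_powR (ltW e0)); rewrite ?nnegrE ?ler0n //.
    by rewrite (ler_nat R 2) prime_gt1.
  case: ltnP => [_|/big_p p2].
    apply: le_trans (_ : C0 * s ^+ a <= _); last first.
      by rewrite ler_pM2l ?lerXn2r ?nnegrE ?powR_ge0 //; lra.
    apply: le_trans (_ : C0 * (1 + a%:R * (s - 1)) <= _).
      have -> : C0 * (1 + a%:R * (s - 1)) = 1 + a%:R * (s - 1) + (s - 1)^-1 + a%:R.
        by rewrite /C0; field; rewrite subr_eq0 gt_eqF.
      have : 0 <= a%:R * (s - 1) by rewrite mulr_ge0 // subr_ge0 ltW.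
      by rewrite -natr1; lra.
    rewrite ler_pM2l; last lra.
    have := @bernoulli_inequality R (s - 1) a.
    by rewrite [1 + (s - 1)]addrC subrK; apply; rewrite subr_ge0 ltW.
  rewrite mul1r; apply: le_trans (_ : 2 ^+ a <= _); last first.
    by rewrite lerXn2r ?nnegrE ?powR_ge0.
  by rewrite -natrX ler_nat ltn_expl.
have main n : (0 < n)%N -> (size (divisors n))%:R <=
    C0 ^+ count (fun p => p < P0)%N (primes n) * n%:R `^ eps.
  elim/ltn_ind: n => n IH n0.
  have [n1|n1] := leqP n 1%N.
    have -> : n = 1%N by lia.
    by rewrite powR1 /= mulr1.
  pose p := pdiv n; have pp : prime p := pdiv_prime n1.
  set m := (n`_p^')%N; set a := logn p n.
  have m0 : (0 < m)%N := part_gt0 _ _.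
  have nE : n = (p ^ a * m)%N by rewrite -p_part partnC.
  have a0 : (0 < a)%N by rewrite logn_gt0 mem_primes pp n0 pdiv_dvd.
  have mn : (m < n)%N.
    by rewrite nE ltn_Pmull // -(exp1n a) ltn_exp2r // prime_gt1.
  have memE r : (r \in primes m) = (r != p) && (r \in primes n).
    by rewrite primes_part mem_filter.
  have perm : perm_eq (primes n) (p :: primes m).
    apply: uniq_perm; rewrite ?primes_uniq //= ?primes_uniq ?andbT.
      by rewrite memE eqxx.
    move=> r; rewrite in_cons memE.
    by case: eqVneq => //= ->; rewrite mem_primes pp n0 pdiv_dvd.
  rewrite (permP perm) /= exprD.
  have -> : n%:R `^ eps = (p%:R `^ eps) ^+ a * m%:R `^ eps :> R.
    have pR : 0 <= p%:R :> R := ler0n _ _.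
    rewrite [in LHS]nE natrM natrX powRM ?exprn_ge0 ?ler0n //; congr (_ * _).
    by rewrite (powR_natmul _ _ pR) -(powR_mulrn _ pR) -powRrM mulrC.
  apply: le_trans (_ : a.+1%:R * (size (divisors m))%:R <= _).
    by rewrite -natrM ler_nat size_divisors_part.
  have -> : C0 ^+ (p < P0)%N = if (p < P0)%N then C0 else 1 by case: ifP.
  rewrite mulrACA; apply: ler_pM => //; first exact: step.
  exact: IH.
exists (C0 ^+ P0); first by rewrite exprn_gt0 //; lra.
move=> n n0; apply: le_trans (main n n0) _.
rewrite ler_wpM2r ?powR_ge0 // ler_weXn2l //.
(* At most [P0] primes lie below [P0]. *)
rewrite -size_filter -[leqRHS](size_iota 0).
apply: uniq_leq_size; first by rewrite filter_uniq // primes_uniq.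
by move=> p; rewrite mem_filter mem_iota => /andP[].
Qed.

(** Comparison with 1 + ln n, where ln n <= n^delta/delta. *)
Lemma harm_le {R : realType} (delta : R) : 0 < delta ->
  exists2 C : R, 0 < C & forall n : nat, (0 < n)%N -> harm R n <= C * n%:R `^ delta.
Proof.
move=> d0.
have hln n : harm R n.+1 <= 1 + ln n.+1%:R.
  elim: n => [|n IH]; first by rewrite /harm big_nat1 invr1 ln1 addr0.
  rewrite /harm big_nat_recr //= -/(harm R n.+1).
  have nR : 0 < n.+2%:R :> R by rewrite ltr0n.
  have n1 : 0 < n.+1%:R :> R by rewrite ltr0n.
  have v1 : n.+2%:R^-1 < 1 :> R by rewrite invf_lt1 // (ltr_nat R 1).
  (* The induction step rests on ln(1 - 1/(n + 2)) <= -1/(n + 2). *)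
  have := @le_ln1Dx R (- n.+2%:R^-1); rewrite ltrN2 => /(_ v1).
  have -> : 1 - n.+2%:R^-1 = n.+1%:R / n.+2%:R :> R.
    by rewrite -[in RHS]natr1; field; rewrite ?natr1 ?pnatr_eq0.
  rewrite ln_div ?posrE //.
  by move: IH; move: (ln _) (ln _) (harm _ _) (_^-1) => x y z t *; lra.
exists (1 + delta^-1); first by rewrite addr_gt0 // invr_gt0.
case=> // n _; apply: le_trans (hln n) _.
have n1 : 1 <= n.+1%:R :> R by rewrite (ler_nat R 1).
rewrite mulrDl mul1r; apply: lerD.
  by have := ler_powR n1 (ltW d0); rewrite powRr0.
rewrite mulrC ler_pdivlMr // mulrC -ln_powR.
by apply/ltW/ln_sublinear/powR_gt0; rewrite ltr0n.
Qed.

(** * Sawtooth sums over k-free integers *)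

(** For [gamma] = 1/alpha this is the number of times the Beatty sequence takes the value m, less
    its mean 1/alpha; see [beatty_err_hit_index]. *)
Definition beatty_err {R : realType} (gamma beta : R) (m : nat) : R :=
  sawtooth (- ((m%:R + 1 - beta) * gamma)) - sawtooth (- ((m%:R - beta) * gamma)).

Lemma beatty_err_le1 {R : realType} (gamma beta : R) m :
  `|beatty_err gamma beta m| <= 1.
Proof.
have := sawtooth_bound (- ((m%:R + 1 - beta) * gamma)).
have := sawtooth_bound (- ((m%:R - beta) * gamma)).
by rewrite /beatty_err ler_norml; lra.
Qed.

(** Along multiples of [D] both sawtooth arguments rotate by -gamma D, so [sum_sawtooth_le] applies
    twice and its constant 5 doubles. *)
Lemma sum_beatty_err_multiples {R : realType} (gamma beta : R) (D L : nat) :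
  (forall h, (0 < h)%N -> 0 < dist_int (gamma * h%:R)) -> (0 < D)%N ->
  `|\sum_(1 <= l < L.+1) beatty_err gamma beta (l * D)| <=
  10 * \sum_(1 <= h < L.+1)
    h%:R^-1 * Num.min L%:R (1 / dist_int (gamma * (h * D)%N%:R)).
Proof.
move=> pos D0; rewrite big_add1 /=.
pose theta : R := - (gamma * D%:R).
have distE h : dist_int (theta * h%:R) = dist_int (gamma * (h * D)%N%:R).
  by rewrite -dist_intN; congr dist_int; rewrite /theta natrM; ring.
have posD h : (0 < h)%N -> 0 < dist_int (theta * h%:R).
  by move=> h0; rewrite distE pos // muln_gt0 h0.
have saw c : `|\sum_(0 <= i < L) sawtooth (- (((i.+1 * D)%N%:R + c - beta) * gamma))|
    <= 5 * \sum_(1 <= h < L.+1)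
      h%:R^-1 * Num.min L%:R (1 / dist_int (gamma * (h * D)%N%:R)).
  rewrite (eq_bigr (fun i => sawtooth (theta * i%:R - (D%:R + c - beta) * gamma))).
    apply: le_trans (sum_sawtooth_le posD L _) _.
    by under eq_bigr do rewrite distE.
  by move=> i _; congr sawtooth; rewrite /theta natrM -natr1; ring.
rewrite /beatty_err sumrB; apply: le_trans (ler_normB _ _) _.
have saw0 := saw 0; rewrite (eq_bigr (fun i =>
  sawtooth (- (((i.+1 * D)%N%:R - beta) * gamma)))) in saw0; last first.
  by move=> i _; rewrite addr0.
by have := saw 1; lra.
Qed.

Lemma sum_kfree_le {R : realType} (k M : nat) (w : nat -> R) : (0 < k)%N ->
  `|\sum_(1 <= m < M.+1 | m%:Z \in kfree k) w m| <=
  \sum_(1 <= d < M.+1) `|\sum_(1 <= l < (M %/ d ^ k).+1) w (l * d ^ k)%N|.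
Proof.
move=> k0.
have -> : \sum_(1 <= m < M.+1 | m%:Z \in kfree k) w m =
    \sum_(1 <= m < M.+1) \sum_(1 <= d < M.+1 | (d ^ k %| m)%N) (moebius d)%:~R * w m.
  rewrite big_mkcond big_nat [RHS]big_nat; apply: eq_bigr => m m1.
  rewrite -mulr_suml -rmorph_sum sum_moebius_kfree //.
  by case: (_ \in _); rewrite ?mul1r ?mul0r.
rewrite (eq_bigr (fun m => \sum_(1 <= d < M.+1)
    if (d ^ k %| m)%N then (moebius d)%:~R * w m else 0)); last first.
  by move=> m _; rewrite big_mkcond.
rewrite exchange_big /=; apply: le_trans (ler_norm_sum _ _ _) _.
apply: ler_sum_nat => d /andP[d0 _].
rewrite -big_mkcond /= -mulr_sumr big_nat_dvd ?expn_gt0 ?d0 // normrM.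
apply: ler_piMl => //.
by rewrite -intr_norm lerz1 normr_moebius_le1.
Qed.

(** If d^k divides n, so does d. *)
Lemma sum_dvd_le_size_divisors (k M n : nat) : (0 < k)%N -> (0 < n)%N ->
  (\sum_(1 <= d < M.+1 | (d ^ k %| n)%N) 1 <= size (divisors n))%N.
Proof.
move=> k0 n0; rewrite sum1_count -size_filter.
apply: uniq_leq_size; first by rewrite filter_uniq // iota_uniq.
move=> d; rewrite mem_filter -dvdn_divisors // => /andP[dn _].
by apply: dvdn_trans dn; rewrite dvdn_exp.
Qed.

(** The cut [y] between small and large d and the denominator [q] stay free here;
    [sum_kfree_beatty_err_powR] optimizes them. *)
Lemma sum_kfree_beatty_err_le {R : realType} (gamma beta y D : R) (k q M : nat)
    (a : int) :
  (forall h, (0 < h)%N -> 0 < dist_int (gamma * h%:R)) ->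
  (0 < q)%N -> coprimez q a -> `|gamma * q%:R - a%:~R| <= q%:R^-1 ->
  (0 < k)%N -> (0 < M)%N -> 0 < y ->
  (forall n, (0 < n <= M)%N -> (size (divisors n))%:R <= D) ->
  `|\sum_(1 <= m < M.+1 | m%:Z \in kfree k) beatty_err gamma beta m| <=
  10 * (D * (8 * q%:R + 2 * q%:R * harm R q
             + harm R M * (8 * (M%:R / q%:R) + 4 * y ^+ k * harm R q)))
  + M%:R / y ^+ k.-1 * harm R M.
Proof.
move=> pos q0 cop app k0 M0 y0 HD.
apply: le_trans (sum_kfree_le _ _ k0) _.
pose f n : R := n%:R^-1 * Num.min M%:R (Num.min (y ^+ k) n%:R / dist_int (gamma * n%:R)).
have f0 n : 0 <= f n.
  rewrite mulr_ge0 ?invr_ge0 // le_min ler0n divr_ge0 ?dist_int_ge0 //.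
  by rewrite le_min exprn_ge0 ?ler0n // ltW.
have bd d : (0 < d)%N ->
    `|\sum_(1 <= l < (M %/ d ^ k).+1) beatty_err gamma beta (l * d ^ k)%N| <=
    10 * \sum_(1 <= n < M.+1 | (d ^ k %| n)%N) f n
      + M%:R / y ^+ k.-1 * d%:R^-1.
  move=> d0.
  have dk0 : (0 < d ^ k)%N by rewrite expn_gt0 d0.
  have dR : 0 < d%:R :> R by rewrite ltr0n.
  have [dy|yd] := leP d%:R y.
    apply: le_trans (_ : 10 * \sum_(1 <= n < M.+1 | (d ^ k %| n)%N) f n <= _);
      last by rewrite lerDl mulr_ge0 ?invr_ge0 // divr_ge0 // exprn_ge0 // ltW.
    apply: le_trans (sum_beatty_err_multiples beta _ pos dk0) _.
    rewrite ler_pM2l // big_nat_dvd //.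
    apply: ler_sum_nat => h /andP[h0 _].
    have hR : 0 < h%:R :> R by rewrite ltr0n.
    have dkR : 0 < (d ^ k)%N%:R :> R by rewrite ltr0n.
    rewrite /f; set del := dist_int _.
    have del0 : 0 < del by rewrite pos // muln_gt0 h0.
    (* With n = h d^k, 1/h is d^k/n; the factor d^k moves into the minimum, where it is at most y^k
       and at most n. *)
    have -> : h%:R^-1 = (h * d ^ k)%N%:R^-1 * (d ^ k)%N%:R :> R.
      by rewrite natrM; field; rewrite !gt_eqF.
    rewrite -mulrA ler_wpM2l ?invr_ge0 // le_min; apply/andP; split.
      apply: le_trans (_ : (d ^ k)%N%:R * (M %/ d ^ k)%N%:R <= _).
        by rewrite ler_pM2l // ge_min lexx.
      by rewrite -natrM ler_nat mulnC leq_divM.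
    rewrite ler_pdivlMr //.
    apply: le_trans (_ : (d ^ k)%N%:R * (1 / del) * del <= _).
      by rewrite ler_wpM2r ?(ltW del0) // ler_pM2l // ge_min lexx orbT.
    rewrite mul1r mulfVK ?gt_eqF // le_min; apply/andP; split.
      by rewrite natrX lerXn2r ?nnegrE ?ler0n ?(ltW y0).
    by rewrite ler_nat leq_pmull.
  apply: le_trans (_ : M%:R / y ^+ k.-1 * d%:R^-1 <= _); last first.
    by rewrite lerDr mulr_ge0 // sumr_ge0.
  apply: le_trans (_ : (M %/ d ^ k)%N%:R <= _).
    apply: le_trans (ler_norm_sum _ _ _) _.
    apply: le_trans (_ : \sum_(1 <= l < (M %/ d ^ k).+1) (1 : R) <= _).
      by apply: ler_sum => l _; apply: beatty_err_le1.
    by rewrite sumr_const_nat subn1.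
  apply: le_trans (_ : M%:R / (d ^ k)%N%:R <= _).
    by rewrite ler_pdivlMr ?ltr0n // -natrM ler_nat leq_divM.
  (* For d > y, d^k >= y^(k-1) d; keeping one factor d leaves a harmonic sum. *)
  rewrite -mulrA ler_wpM2l // -invfM lef_pV2 ?posrE ?mulr_gt0 ?exprn_gt0 ?ltr0n //.
  rewrite natrX -{2}(prednK k0) exprSr ler_pM2r //.
  by rewrite lerXn2r ?nnegrE ?ler0n ?(ltW y0) ?(ltW yd).
apply: le_trans (_ : \sum_(1 <= d < M.+1)
   (10 * \sum_(1 <= n < M.+1 | (d ^ k %| n)%N) f n
      + M%:R / y ^+ k.-1 * d%:R^-1) <= _).
  apply: ler_sum_nat => d /andP[d0 _].
  exact: bd.
rewrite big_split /= -!mulr_sumr lerD2r ler_pM2l //.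
rewrite (eq_bigr (fun d => \sum_(1 <= n < M.+1) if (d ^ k %| n)%N then f n else 0));
  last by move=> d _; rewrite big_mkcond.
rewrite exchange_big /=.
(* After the exchange each n occurs once for every d with d^k | n, hence at most [D] times. *)
apply: le_trans (_ : \sum_(1 <= n < M.+1) D * f n <= _).
  apply: ler_sum_nat => n /andP[n0 nM].
  rewrite -big_mkcond /=.
  apply: le_trans (_ : (\sum_(1 <= d < M.+1 | (d ^ k %| n)%N) 1)%N%:R * f n <= _).
    by rewrite natr_sum mulr_suml; under [leRHS]eq_bigr do rewrite mul1r.
  rewrite ler_wpM2r //; apply: le_trans (HD n _); last by rewrite n0.
  by rewrite ler_nat sum_dvd_le_size_divisors.
rewrite -mulr_sumr.
have D0 : 0 <= D by apply: le_trans (HD 1%N _) => //; rewrite M0.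
have yk0 : 0 <= y ^+ k by rewrite exprn_ge0 // ltW.
by rewrite ler_wpM2l //; apply: sum_reciprocal_dist_le app yk0.
Qed.

(** * Irrationality type and powers of M *)

Lemma dist_int_irrational_gt0 {R : realType} (alpha : R) (q : nat) :
  irrational alpha -> (0 < q)%N -> 0 < dist_int (alpha * q%:R).
Proof.
move=> irr q0; rewrite lt_neqAle dist_int_ge0 andbT eq_sym.
apply/eqP => d0; apply: irr.
have [m] := dist_int_attained (alpha * q%:R); rewrite d0 => /esym/eqP.
rewrite normr_eq0 subr_eq0 => /eqP e.
apply/rationalP; exists m, q.
by rewrite -e mulfK // pnatr_eq0 -lt0n.
Qed.

Lemma pos_lower_bound_prefix {R : realType} (u : nat -> R) (N : nat) :
  (forall q, (0 < q)%N -> 0 < u q) ->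
  exists2 c : R, 0 < c & forall q, (0 < q < N)%N -> c <= u q.
Proof.
move=> u0; elim: N => [|N [c c0 Hc]]; first by exists 1 => // q; rewrite ltn0 andbF.
have [->|N0] := posnP N; first by exists 1 => // q; rewrite ltnS leqn0 lt0n => /andP[/negbTE ->].
exists (Num.min c (u N)); first by rewrite lt_min c0 u0.
move=> q /andP[q0]; rewrite ltnS leq_eqVlt => /predU1P[->|qN].
  by rewrite ge_min lexx orbT.
by rewrite ge_min Hc ?q0.
Qed.

(** If no c works, q^t times the distance falls below every positive bound at arbitrarily large q.
    Its lower limit is then 0, so t is at most the type, against [tau < t]. *)
Lemma diophantine_type_lower {R : realType} (alpha tau t : R) :
  irrational alpha -> diophantine_type alpha = tau%:E -> tau < t ->
  exists2 c : R, 0 < c &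
    forall q : nat, (0 < q)%N -> c <= q%:R `^ t * dist_int (alpha * q%:R).
Proof.
move=> irr typ taut; apply: contrapT => nex.
pose u (q : nat) : R := q%:R `^ t * dist_int (alpha * q%:R).
have u0 q : (0 < q)%N -> 0 < u q.
  by move=> q0; rewrite mulr_gt0 ?powR_gt0 ?ltr0n // dist_int_irrational_gt0.
(* The finitely many values before [N] have a positive minimum, so a lower bound beyond [N] would
   extend to all q. *)
have small c N : 0 < c -> exists2 q, (N <= q)%N & u q < c.
  move=> c0; have [b b0 Hb] := pos_lower_bound_prefix N u0.
  apply: contrapT => nq; apply: nex; exists (Num.min b c); first by rewrite lt_min b0.
  move=> q q0; have [qN|Nq] := ltnP q N; first by rewrite ge_min Hb // q0.
  rewrite ge_min; apply/orP; right; rewrite leNgt; apply/negP => uc.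
  by apply: nq; exists q.
suff lim0 : limn_einf (fun q : nat => (q%:R `^ t * dist_int (alpha * q%:R))%:E) = 0%E.
  have : (t%:E <= diophantine_type alpha)%E.
    by apply: ereal_sup_ubound; exists t.
  by rewrite typ lee_fin leNgt taut.
rewrite limn_einf_lim.
have -> : einfs (fun q : nat => (u q)%:E) = fun=> 0%E; last exact: lim_cst.
apply/funext => n; apply/le_anti/andP; split; last first.
  apply: le_ereal_inf_tmp => _ [q _ <-].
  by rewrite lee_fin mulr_ge0 ?powR_ge0 ?dist_int_ge0.
apply/lee_addgt0Pr => e e0; rewrite add0e.
have [q nq uq] := small e n e0.
apply: ge_ereal_inf; exists (u q)%:E; first by exists q.
by rewrite lee_fin ltW.
Qed.

(** If t <= 0 then q^t <= 1, while Dirichlet's theorem makes the distance smaller than c. *)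
Lemma diophantine_exponent_gt0 {R : realType} (alpha t c : R) : 0 < c ->
  (forall q : nat, (0 < q)%N -> c <= q%:R `^ t * dist_int (alpha * q%:R)) ->
  0 < t.
Proof.
move=> c0 H; rewrite ltNge; apply/negP => t0.
pose N := (Num.truncn c^-1).+1.
have [q [a /andP[q0 _] [_ app]]] := @dirichlet R alpha N isT.
have Nc : N%:R^-1 < c.
  by rewrite -[ltRHS]invrK ltf_pV2 ?posrE ?invr_gt0 // truncnS_gt.
have := H q q0; rewrite leNgt => /negP; apply.
apply: le_lt_trans Nc; apply: le_trans (_ : 1 * dist_int (alpha * q%:R) <= _).
  rewrite ler_wpM2r ?dist_int_ge0 // -[leRHS](powRr0 q%:R) ler_powR //.
  by rewrite (ler_nat R 1).
by rewrite mul1r; apply: le_trans (dist_int_le _ a) app.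
Qed.

(** If p is nearest to q/alpha, then |alpha p - q| = alpha |q/alpha - p|, so the bound for alpha at
    p passes to 1/alpha at q when 1 <= p <= q. For other p the distance is at least 1/alpha. *)
Lemma diophantine_lower_inv {R : realType} (alpha t c : R) :
  1 < alpha -> 0 < c -> 0 <= t ->
  (forall q : nat, (0 < q)%N -> c <= q%:R `^ t * dist_int (alpha * q%:R)) ->
  exists2 c' : R, 0 < c' &
    forall q : nat, (0 < q)%N -> c' <= q%:R `^ t * dist_int (alpha^-1 * q%:R).
Proof.
move=> a1 c0 t0 H.
have a0 : 0 < alpha by lra.
have g0 : 0 < alpha^-1 by rewrite invr_gt0.
have g1 : alpha^-1 < 1 by rewrite invf_lt1.
exists (Num.min alpha^-1 (c / alpha)); first by rewrite lt_min g0 divr_gt0.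
move=> q q0; have q1 : 1 <= q%:R :> R by rewrite ler1n.
have qt : 1 <= q%:R `^ t by have := ler_powR q1 t0; rewrite powRr0.
have big d : alpha^-1 <= d ->
    Num.min alpha^-1 (c / alpha) <= q%:R `^ t * d.
  move=> gd; rewrite ge_min; apply/orP; left.
  have d0 : 0 <= d := le_trans (ltW g0) gd.
  by apply: (le_trans gd); rewrite ler_peMl.
have [p ->] := dist_int_attained (alpha^-1 * q%:R).
have gq : alpha^-1 <= alpha^-1 * q%:R by rewrite ler_peMr // ltW.
have gq1 : alpha^-1 * q%:R <= q%:R by rewrite ler_piMl // ltW.
have [p0|p0] := leP p 0.
  apply: big; apply: le_trans gq _; apply: le_trans (ler_norm _).
  by rewrite lerBrDr gerDl (ler_int R p 0).
have [qp|pq] := ltP q%:Z p.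
  apply: big; rewrite -normrN; apply: le_trans (ler_norm _).
  move: qp; rewrite -lezD1 -(ler_int R) rmorphD /= => qp; lra.
case: p p0 pq => // p p0 pq.
rewrite ge_min; apply/orP; right.
rewrite ler_pdivrMr //; apply: le_trans (H p p0) _.
rewrite -mulrA; apply: ler_pM; rewrite ?powR_ge0 ?dist_int_ge0 //.
  by apply: (ge0_ler_powR t0); rewrite ?nnegrE ?ler0n // ler_nat.
apply: le_trans (dist_int_le _ q) _.
rewrite -!pmulrn.
have -> : alpha * p%:R - q%:R = - ((alpha^-1 * q%:R - p%:R) * alpha).
  by field; rewrite gt_eqF.
by rewrite normrN normrM (gtr0_norm a0).
Qed.

Lemma sum_kfree_beatty_err_powR {R : realType} (gamma beta t c eps : R) (k : nat) :
  (2 <= k)%N -> 0 < t -> 0 < c -> 0 < eps ->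
  (forall h, (0 < h)%N -> 0 < dist_int (gamma * h%:R)) ->
  (forall q : nat, (0 < q)%N -> c <= q%:R `^ t * dist_int (gamma * q%:R)) ->
  exists2 C : R, 0 < C & forall M : nat, (0 < M)%N ->
    `|\sum_(1 <= m < M.+1 | m%:Z \in kfree k) beatty_err gamma beta m| <=
    C * (M%:R `^ (k%:R / (2 * k%:R - 1) + eps) + M%:R `^ (t / (t + 1) + eps)).
Proof.
move=> k2 t0 c0 eps0 pos low.
have k0 : (0 < k)%N := ltnW k2.
(* At most three factors M^delta get multiplied: the divisor bound and two harmonic sums. *)
pose delta := eps / 3.
have d0 : 0 < delta by rewrite divr_gt0.
have [Cd Cd0 HD] := size_divisors_le d0.
have [Ch Ch0 HH] := @harm_le R delta d0.
(* The factor 2^delta serves [harm R q], as q is only known to be at most 2M. *)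
pose c1 := Ch * 2 `^ delta.
have two1 : 1 <= 2 `^ delta :> R.
  by have := @ler_powR R 2 _ 0 delta (ltW d0); rewrite powRr0; apply; rewrite ler1n.
have c10 : 0 < c1 by rewrite mulr_gt0 // powR_gt0.
have Chc1 : Ch <= c1 by rewrite ler_peMr // ltW.
pose K := c `^ (- t^-1).
have K0 : 0 < K by rewrite powR_gt0.
exists (10 * Cd * (16 + 4 * c1 + 8 * c1 * K + 4 * c1 * c1) + c1).
  by rewrite addr_gt0 // !mulr_gt0 // !addr_gt0 // !mulr_gt0.
move=> M M0.
set X : R := M%:R.
have X1 : 1 <= X by rewrite ler1n.
have X0 : 0 < X by lra.
(* This exponent gives q and M/q upper bounds of the same order M^sigma. *)
pose sigma := t / (t + 1).
have s0 : 0 < sigma by rewrite divr_gt0 //; lra.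
have s1 : sigma < 1 by rewrite ltr_pdivrMr; lra.
pose S := X `^ sigma; pose E := X `^ delta; pose P := X `^ (k%:R / (2 * k%:R - 1)).
have S1 : 1 <= S by have := ler_powR X1 (ltW s0); rewrite powRr0.
have SX : S <= X by apply: ler1_powR => //; exact: ltW.
have E1 : 1 <= E by have := ler_powR X1 (ltW d0); rewrite powRr0.
have P0 : 0 < P by rewrite powR_gt0.
pose N := (Num.truncn S).+1.
have SN : S < N%:R := truncnS_gt _.
have N2S : N%:R <= 2 * S.
  have : (Num.truncn S)%:R <= S by rewrite truncn_le; lra.
  by rewrite /N -natr1; lra.
have [q [a /andP[q0 qN] [cop app]]] := @dirichlet R gamma N isT.
have qR : 0 < q%:R :> R by rewrite ltr0n.
have q2S : q%:R <= 2 * S by apply: le_trans N2S; rewrite ler_nat.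
have appq : `|gamma * q%:R - a%:~R| <= q%:R^-1.
  by apply: le_trans app _; rewrite lef_pV2 ?posrE ?ltr0n // ler_nat.
(* The distance at q is at most 1/N < 1/S and at least c q^(-t), so q^t >= c S; then sigma + sigma/t
   = 1 gives the claim. *)
have Xq : X / q%:R <= K * S.
  have Xt : c * S <= q%:R `^ t.
    have S0 : 0 < S := lt_le_trans ltr01 S1.
    rewrite -ler_pdivlMr //.
    apply: le_trans (low q q0) _; rewrite ler_wpM2l ?powR_ge0 //.
    apply: le_trans (dist_int_le _ a) _; apply: le_trans app _.
    by rewrite lef_pV2 ?posrE ?ltr0n ?(ltW SN) //; lra.
  have tV : 0 <= t^-1 by rewrite invr_ge0 ltW.
  have := @ge0_ler_powR R _ tV (c * S) (q%:R `^ t).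
  rewrite !nnegrE powR_ge0 mulr_ge0; [|lra|lra] => /(_ isT isT Xt).
  rewrite -powRrM divff ?gt_eqF // powRr1; last exact: ltW.
  rewrite powRM; [|lra|lra]; rewrite /S -powRrM => le_q.
  rewrite ler_pdivrMr //.
  apply: le_trans (_ : K * X `^ sigma * (c `^ t^-1 * X `^ (sigma * t^-1)) <= _); last first.
    by rewrite ler_wpM2l // mulr_ge0 // ?powR_ge0 // ltW.
  rewrite mulrACA /K -!powRD; try by rewrite ?(gt_eqF c0) ?(gt_eqF X0) implybT.
  rewrite addNr powRr0 mul1r.
  have -> : sigma + sigma / t = 1.
    by rewrite /sigma; field; rewrite gt_eqF //= gt_eqF //; lra.
  by rewrite powRr1 // ltW.
have HM : harm R M <= c1 * E.
  by apply: le_trans (HH M M0) _; rewrite ler_wpM2r // powR_ge0.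
have Hq : harm R q <= c1 * E.
  apply: le_trans (HH q q0) _; rewrite /c1 -mulrA ler_pM2l // -powRM //.
  by apply: (ge0_ler_powR (ltW d0)); rewrite ?nnegrE; lra.
have HDM n : (0 < n <= M)%N -> (size (divisors n))%:R <= Cd * E.
  move=> /andP[n0 nM]; apply: le_trans (HD n n0) _; rewrite ler_pM2l //.
  by apply: (ge0_ler_powR (ltW d0)); rewrite ?nnegrE ?ler0n // ler_nat.
(* This [y] balances y^k against M/y^(k-1): both equal [P]. *)
pose y := X `^ (2 * k%:R - 1)^-1.
have y0 : 0 < y by rewrite powR_gt0.
have k2R : 2 <= k%:R :> R by rewrite (ler_nat R 2).
have yk : y ^+ k = P by rewrite powR_natmul ?(ltW X0) // mulrC.
have yk1 : X / y ^+ k.-1 = P.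
  rewrite powR_natmul ?(ltW X0) // -powRN -{1}(powRr1 (ltW X0)) -powRD; last first.
    by rewrite (gt_eqF X0) implybT.
  have k1E : k.-1%:R = k%:R - 1 :> R by rewrite -{2}(prednK k0) -natr1 addrK.
  have den0 : 2 * k%:R - 1 != 0 :> R by rewrite gt_eqF //; lra.
  rewrite k1E /P; move: (k%:R : R) den0 => K' den0.
  have -> : 1 - (2 * K' - 1)^-1 * (K' - 1) = K' / (2 * K' - 1) by field.
  by [].
apply: le_trans (sum_kfree_beatty_err_le beta pos q0 cop appq k0 M0 y0 HDM) _.
rewrite yk -/X yk1.
have hq0 := @harm_ge0 R q; have hM0 := @harm_ge0 R M.
have cE0 : 0 <= c1 * E by apply: le_trans hq0 Hq.
have EE : E <= E ^+ 2 by rewrite ler_eXnr.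
have E21 : 1 <= E ^+ 2 by apply: le_trans EE.
have E3 : E <= E ^+ 3 by rewrite ler_eXnr.
have b1 : 8 * q%:R <= 16 * S * E ^+ 2.
  apply: le_trans (_ : 16 * S <= _); first lra.
  by rewrite ler_peMr //; lra.
have b2 : 2 * q%:R * harm R q <= 4 * c1 * S * E ^+ 2.
  apply: le_trans (_ : 4 * S * (c1 * E) <= _).
    by apply: ler_pM => //; lra.
  have -> : 4 * S * (c1 * E) = 4 * c1 * S * E by ring.
  by rewrite ler_wpM2l // !mulr_ge0 //; lra.
have b3 : harm R M * (8 * (X / q%:R) + 4 * P * harm R q)
    <= (8 * c1 * K * S + 4 * c1 * c1 * P) * E ^+ 2.
  apply: le_trans (_ : c1 * E * (8 * (K * S) + 4 * P * (c1 * E)) <= _).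
    apply: ler_pM => //.
      by rewrite addr_ge0 // mulr_ge0 ?divr_ge0 ?(ltW X0) ?(ltW qR) // mulr_ge0 // ltW.
    by apply: lerD; [rewrite ler_pM2l | rewrite ler_pM2l // mulr_gt0].
  have -> : c1 * E * (8 * (K * S) + 4 * P * (c1 * E)) =
    8 * c1 * K * S * E + 4 * c1 * c1 * P * E ^+ 2 by ring.
  rewrite [leRHS]mulrDl; apply: lerD => //.
  by rewrite ler_wpM2l // !mulr_ge0 //; lra.
have b4 : P * harm R M <= c1 * P * E ^+ 3.
  apply: le_trans (_ : P * (c1 * E) <= _); first by rewrite ler_pM2l.
  have -> : P * (c1 * E) = c1 * P * E by ring.
  by rewrite ler_wpM2l // mulr_ge0 // ltW.
have E3E z : X `^ (z + eps) = X `^ z * E ^+ 3.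
  rewrite powR_natmul ?(ltW X0) // -powRD; last by rewrite (gt_eqF X0) implybT.
  rewrite (_ : eps = delta * 3%:R) // /delta.
  by field.
rewrite !E3E -/P -/sigma -/S.
apply: le_trans (_ : 10 * (Cd * E * (16 * S * E ^+ 2 + 4 * c1 * S * E ^+ 2 +
   (8 * c1 * K * S + 4 * c1 * c1 * P) * E ^+ 2)) + c1 * P * E ^+ 3 <= _).
  apply: lerD => //; rewrite ler_pM2l // ler_wpM2l ?lerD //.
  by rewrite mulr_ge0 //; lra.
(* The claimed bound exceeds the collected one by nonnegative cross terms only. *)
rewrite -subr_ge0.
rewrite [X in 0 <= X](_ : _ = 10 * Cd * E ^+ 3 * ((16 + 4 * c1 + 8 * c1 * K) * P
  + 4 * c1 * c1 * S) + c1 * S * E ^+ 3); last by ring.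
have S0 : 0 <= S by lra.
have E0 : 0 <= E ^+ 3 by lra.
have [Cd0' c10' K0' P0'] := And4 (ltW Cd0) (ltW c10) (ltW K0) (ltW P0).
move: (E ^+ 3) (S) (P) (c1) (K) E0 S0 P0' c10' K0' => e s p c' K' *.
apply: addr_ge0; last by rewrite !mulr_ge0.
apply: mulr_ge0; first by rewrite !mulr_ge0.
by apply: addr_ge0; rewrite !mulr_ge0 // !addr_ge0 // !mulr_ge0.
Qed.

(** * Values of the Beatty sequence *)

(* [hit_index m] is the least integer n with alpha n + beta >= m, so that the
   Beatty sequence takes the value m exactly hit_index (m + 1) - hit_index m
   times. *)
Definition hit_index {R : realType} (alpha beta : R) (m : nat) : int :=
  - Num.floor (- ((m%:R - beta) * alpha^-1)).

Lemma hit_index_bounds {R : realType} (alpha beta : R) (m : nat) :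
  0 < alpha ->
  m%:R <= alpha * (hit_index alpha beta m)%:~R + beta < m%:R + alpha.
Proof.
move=> a0; have := floor_itv (- ((m%:R - beta) * alpha^-1)).
rewrite /hit_index rmorphN rmorphD /= => /andP[].
set z : R := (Num.floor _)%:~R.
have -> : - ((m%:R - beta) * alpha^-1) = - (m%:R - beta) / alpha by rewrite mulNr.
by rewrite ler_pdivlMr // ltr_pdivrMr //; nra.
Qed.

(** A unit step in m moves (m - beta)/alpha by 1/alpha < 1, so each value is taken at most once. *)
Lemma hit_index_step {R : realType} (alpha beta : R) (m : nat) : 1 < alpha ->
  hit_index alpha beta m <= hit_index alpha beta m.+1 <= hit_index alpha beta m + 1.
Proof.
move=> a1; have a0 : 0 < alpha by lra.
have /andP[l1 u1] := hit_index_bounds beta m a0.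
have /andP[l2 u2] := hit_index_bounds beta m.+1 a0.
rewrite -natr1 in l2 u2.
rewrite -!ltzD1 -!(ltr_int R) !rmorphD /=; apply/andP; split.
  by rewrite -(ltr_pM2l a0); lra.
by rewrite -(ltr_pM2l a0); lra.
Qed.

(** The next index is the first to reach m + 1, so at this one the sequence is still below m + 1. *)
Lemma floor_hit_index {R : realType} (alpha beta : R) (m : nat) : 1 < alpha ->
  hit_index alpha beta m.+1 = hit_index alpha beta m + 1 ->
  Num.floor (alpha * (hit_index alpha beta m)%:~R + beta) = m.
Proof.
move=> a1 e; have a0 : 0 < alpha by lra.
have /andP[l1 u1] := hit_index_bounds beta m a0.
have /andP[l2 u2] := hit_index_bounds beta m.+1 a0.
rewrite e rmorphD /= -natr1 in u2.
by apply/floor_def; rewrite rmorphD /= -!pmulrn l1 /=; lra.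
Qed.

(** The halves cancel and the linear parts differ by -1/alpha. *)
Lemma beatty_err_hit_index {R : realType} (alpha beta : R) (m : nat) :
  beatty_err alpha^-1 beta m =
  (hit_index alpha beta m.+1 - hit_index alpha beta m)%:~R - alpha^-1.
Proof.
rewrite /beatty_err /sawtooth /hit_index rmorphB /= !rmorphN /= natr1 -natr1.
by move: (_%:~R) (_%:~R) => u v; ring.
Qed.

Lemma truncn_intr {R : realType} (z : int) :
  Num.truncn (z%:~R : R) = if 0 <= z then `|z|%N else 0%N.
Proof. by rewrite truncn_floor ler0z intrKfloor. Qed.

(** Sorting the indices n by the value they produce turns the first count into a sum over k-free m,
    up to a number of indices bounded independently of x. *)
Lemma beatty_kfree_count_approx {R : realType} (alpha beta : R) (k : nat) :
  1 < alpha -> exists2 C : R, 0 < C & forall x : R, 1 <= x ->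
  let M := Num.truncn ((Num.floor (alpha * x + beta))%:~R : R) in
  `| beatty_kfree_count k alpha beta x
     - alpha^-1 * kfree_count k (Num.floor (alpha * x + beta))%:~R | <=
  `|\sum_(1 <= m < M.+1 | m%:Z \in kfree k) beatty_err alpha^-1 beta m| + C.
Proof.
move=> a1; have a0 : 0 < alpha by lra.
pose N := hit_index alpha beta.
(* Hit indices may be negative, whereas the count starts at n = 1; [P] and [Q] are their positive
   and negative parts. *)
pose P m := absz (Num.max 0 (N m)); pose Q m := absz (Num.min 0 (N m)).
have NPQ m : (N m)%:~R = (P m)%:R - (Q m)%:R :> R.
  have -> : N m = (P m)%:Z - (Q m)%:Z by rewrite /P /Q; lia.
  by rewrite rmorphB.
have N01 m : N m <= N m.+1 <= N m + 1 := hit_index_step beta m a1.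
pose c (z : int) : R := (z \in kfree k)%:R.
have c01 z : 0 <= c z <= 1 by rewrite /c; case: (_ \in _); rewrite /= ?ler01 ?lexx ?ler01.
pose g (n : nat) : R := c (Num.floor (alpha * n%:R + beta)).
pose G n : R := \sum_(0 <= i < n) g i.
have GS n : G n.+1 = G n + g n by rewrite /G big_nat_recr.
have G0 n : 0 <= G n <= n%:R.
  elim: n => [|n IH]; first by rewrite /G big_geq // lexx.
  have := c01 (Num.floor (alpha * n%:R + beta)).
  by rewrite GS -natr1 /g; lra.
(* The 2 pays for the term n = 0 of [G] and for one index beyond x, [P 1] for nonnegative indices
   with value below 1, [Q 1] for negative indices. *)
exists (2 + (P 1%N)%:R + (Q 1%N)%:R).
  by rewrite ltr_wpDr // ltr_wpDr.
move=> x x1; set y := Num.floor (alpha * x + beta); rewrite /= truncn_intr.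
set X := Num.truncn x.
have /andP[X1 X2] : X%:R <= x < X.+1%:R by apply: truncn_itv; lra.
have beattyE : beatty_kfree_count k alpha beta x = G X.+1 - G 1%N.
  rewrite /beatty_kfree_count -/X big_mkcond /G [in RHS]big_ltn // [in RHS]big_nat1.
  by rewrite [g 0%N + _]addrC addrK; apply: eq_bigr => n _; rewrite /g /c; case: (_ \in _).
rewrite beattyE /kfree_count truncn_intr.
(* For y <= 0 both counts are empty. *)
have [y0|y0] := leP y 0.
  have -> : (if 0 <= y then `|y|%N else 0%N) = 0%N.
    by case: ifP => // y0'; have -> : y = 0 by apply/le_anti; rewrite y0.
  rewrite -beattyE /beatty_kfree_count [X in `|X - _|]big_nat_cond.
  rewrite [X in `|X - _|]big1; last first.
    move=> n /andP[/andP[_ nX] /set_mem[f0 _]].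
    have fy : Num.floor (alpha * n%:R + beta) <= y.
      apply: le_floor; rewrite lerD2r ler_pM2l //.
      by apply: le_trans X1; rewrite ler_nat -ltnS.
    by have := lt_le_trans f0 (le_trans fy y0).
  by rewrite !big_geq // mulr0 subrr normr0 add0r !addr_ge0.
rewrite (ltW y0); set M := `|y|%N.
(* [P] grows only where the hit index does, and then [P m] is the index with value m. *)
have tele : \sum_(1 <= m < M.+1) c m * ((P m.+1)%:R - (P m)%:R) = G (P M.+1) - G (P 1%N).
  elim: M => [|M IH]; first by rewrite big_geq // subrr.
  rewrite big_nat_recr //= IH.
  have /andP[s1 s2] := N01 M.+1.
  have [e|ne] := eqVneq (P M.+2) (P M.+1); first by rewrite e subrr mulr0 addr0.
  have eP : P M.+2 = (P M.+1).+1 by move: ne; rewrite /P; lia.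
  have eN : N M.+2 = N M.+1 + 1 by move: ne; rewrite /P; lia.
  have PN : (P M.+1)%:Z = N M.+1 by move: ne; rewrite /P; lia.
  have fE : Num.floor (alpha * (P M.+1)%:R + beta) = M.+1.
    by rewrite pmulrn PN; apply: floor_hit_index.
  by rewrite eP GS /g fE -natr1; ring.
have Qtele : 0 <= \sum_(1 <= m < M.+1) c m * ((Q m)%:R - (Q m.+1)%:R) <= (Q 1%N)%:R.
  have Qd m : 0 <= (Q m)%:R - (Q m.+1)%:R :> R.
    by rewrite subr_ge0 ler_nat; have := N01 m; rewrite /Q; lia.
  apply/andP; split.
    by apply: sumr_ge0 => m _; rewrite mulr_ge0 //; case/andP: (c01 m).
  apply: le_trans (_ : \sum_(1 <= m < M.+1) ((Q m)%:R - (Q m.+1)%:R) <= _).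
    by apply: ler_sum => m _; rewrite ler_piMl //; case/andP: (c01 m).
  have -> : \sum_(1 <= m < M.+1) ((Q m)%:R - (Q m.+1)%:R) = (Q 1%N)%:R - (Q M.+1)%:R :> R.
    rewrite -[RHS]opprB -(telescope_sumr (fun m => (Q m)%:R : R)) // -sumrN.
    by apply: eq_bigr => m _; rewrite opprB.
  by rewrite gerBl.
have errE : \sum_(1 <= m < M.+1 | m%:Z \in kfree k) beatty_err alpha^-1 beta m =
   \sum_(1 <= m < M.+1) c m * ((P m.+1)%:R - (P m)%:R) +
   \sum_(1 <= m < M.+1) c m * ((Q m)%:R - (Q m.+1)%:R)
   - alpha^-1 * \sum_(1 <= m < M.+1 | m%:Z \in kfree k) 1.
  rewrite [X in _ = _ - _ * X]big_mkcond [LHS]big_mkcond mulr_sumr -big_split -sumrB /=.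
  apply: eq_bigr => m _; rewrite beatty_err_hit_index rmorphB /= -!/(N _) !NPQ /c.
  by case: (_ \in _) => /=; ring.
have yM : (M%:R : R) <= alpha * x + beta < M%:R + 1.
  have := floor_itv (alpha * x + beta); rewrite -/y rmorphD /=.
  by rewrite -[y]gez0_abs ?(ltW y0).
have /andP[l u] := hit_index_bounds beta M.+1 a0; rewrite -/(N _) -natr1 in l u.
(* As M <= alpha x + beta < M + 1, the first index reaching M + 1 is X + 1 or X + 2. *)
have lX : X%:Z < N M.+1.
  rewrite -(ltr_int R) -pmulrn -(ltr_pM2l a0).
  have : alpha * X%:R <= alpha * x by rewrite ler_pM2l.
  by lra.
have uX : N M.+1 < X.+3%:Z.
  rewrite -(ltr_int R) -pmulrn -(ltr_pM2l a0) -addn2 natrD.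
  have : alpha * x < alpha * X.+1%:R by rewrite ltr_pM2l.
  by lra.
have GP : 0 <= G (P M.+1) - G X.+1 <= 1.
  have [->|->] : P M.+1 = X.+1 \/ P M.+1 = X.+2.
    by move: lX uX; rewrite /P; move: (N M.+1) => z; clear; lia.
    by rewrite subrr lexx ler01.
  by rewrite GS addrAC subrr add0r; apply: c01.
have := G0 1%N; have := G0 (P 1%N).
rewrite errE tele; set ckf := alpha^-1 * _.
move: Qtele; set SQ := \sum_(1 <= m < M.+1) _ => Qtele P1 Q1.
set Z := G (P M.+1) - G (P 1%N) + SQ - ckf.
have := ler_norm Z; have := ler_norm (- Z); rewrite normrN => z1 z2.
by rewrite ler_norml; move: z1 z2; rewrite /Z; lra.
Qed.

(** * Choice of exponents and conclusion *)

Unset Implicit Arguments.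

Theorem theorem1p1 (R : realType) (k : nat) (hk : (2 <= k)%N)
    (alpha : R) (alpha_gt1 : 1 < alpha) (alpha_irr : irrational alpha)
    (tau : R) (alpha_type : diophantine_type alpha = tau%:E)
    (beta epsilon : R) (epsilon_gt0 : 0 < epsilon) :
  exists2 C : R, 0 < C & forall x : R, 1 <= x ->
    `| beatty_kfree_count k alpha beta x
       - alpha^-1 * kfree_count k (Num.floor (alpha * x + beta))%:~R |
    <= C * (x `^ (k%:R / (2 * k%:R - 1) + epsilon)
            + x `^ (1 - 1 / (tau + 1) + epsilon)).
Proof.
have a0 : 0 < alpha by lra.
(* A negative [tau] would lie below tau/2 < 0, an exponent excluded by
   [diophantine_exponent_gt0]. *)
have tau_ge0 : 0 <= tau.
  rewrite leNgt; apply/negP => tau0.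
  have tau2 : tau < tau / 2 by lra.
  have [c c0 Hc] := diophantine_type_lower alpha_irr alpha_type tau2.
  by have := diophantine_exponent_gt0 c0 Hc; lra.
(* Half of [epsilon] pays for exceeding the type, the other half for the factors M^delta. *)
pose t := tau + epsilon / 2.
have taut : tau < t by rewrite /t; lra.
have t0 : 0 < t by lra.
have [c c0 Hc] := diophantine_type_lower alpha_irr alpha_type taut.
have [c' c'0 low] := diophantine_lower_inv alpha_gt1 c0 (ltW t0) Hc.
have pos h : (0 < h)%N -> 0 < dist_int (alpha^-1 * h%:R).
  move=> h0; rewrite -(@pmulr_rgt0 _ (h%:R `^ t)) ?powR_gt0 ?ltr0n //.
  exact: lt_le_trans c'0 (low h h0).
have eps2 : 0 < epsilon / 2 by lra.
have [C1 C10 H1] := sum_kfree_beatty_err_powR beta hk t0 c'0 eps2 pos low.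
have [C2 C20 H2] := beatty_kfree_count_approx beta k alpha_gt1.
(* As x >= 1, alpha x + beta <= A x. *)
pose A := alpha + `|beta|.
have A1 : 1 <= A by have := normr_ge0 beta; rewrite /A; lra.
have kR : 2 <= k%:R :> R by rewrite (ler_nat R 2).
have e1_ge0 : 0 <= k%:R / (2 * k%:R - 1) :> R by rewrite divr_ge0 //; lra.
have e2_ge0 : 0 <= t / (t + 1) by rewrite divr_ge0 //; lra.
have e2_le : t / (t + 1) + epsilon / 2 <= 1 - 1 / (tau + 1) + epsilon.
  have -> : t / (t + 1) = 1 - 1 / (tau + 1) + epsilon / 2 / ((tau + 1) * (t + 1)).
    by rewrite /t; field; apply/andP; split; apply: lt0r_neq0; lra.
  have d1 : 1 <= (tau + 1) * (t + 1) by nra.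
  have : epsilon / 2 / ((tau + 1) * (t + 1)) <= epsilon / 2.
    by rewrite ler_pdivrMr ?ler_peMr //; lra.
  by lra.
pose e1 := k%:R / (2 * k%:R - 1) + epsilon / 2; pose e2 := t / (t + 1) + epsilon / 2.
exists (C1 * (A `^ e1 + A `^ e2) + C2).
  by rewrite addr_gt0 // mulr_gt0 // addr_gt0 // powR_gt0 //; lra.
move=> x x1; have x0 : 0 < x by lra.
set T1 := x `^ _; set T2 := x `^ (_ - _ + _).
(* This lets the first power of x absorb the constant [C2]. *)
have T1_ge1 : 1 <= T1.
  by rewrite -(powRr0 x) ler_powR //; lra.
have T2_ge0 : 0 <= T2 by exact: powR_ge0.
apply: le_trans (H2 x x1) _; rewrite mulrDl; apply: lerD; last first.
  by rewrite ler_peMr ?(ltW C20) //; lra.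
set M := Num.truncn _.
have [->|M0] := posnP M.
  by rewrite big_geq // normr0 !mulr_ge0 ?addr_ge0 ?mulr_ge0 ?addr_ge0 ?powR_ge0 // ltW.
have MA : M%:R <= A * x.
  have M1 : 1 <= (Num.floor (alpha * x + beta))%:~R :> R by rewrite -truncn_gt0.
  apply: le_trans (_ : (Num.floor (alpha * x + beta))%:~R <= _).
    by rewrite /M truncn_le; lra.
  apply: le_trans (floor_le _) _; rewrite /A mulrDl lerD2l.
  by apply: le_trans (ler_norm _) _; rewrite ler_peMr.
have powM e e' : 0 <= e -> e <= e' -> M%:R `^ e <= A `^ e * x `^ e'.
  move=> e0 ee'; apply: le_trans (_ : (A * x) `^ e <= _).
    by apply: (ge0_ler_powR e0); rewrite ?nnegrE ?ler0n ?mulr_ge0 //; lra.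
  by rewrite powRM; [rewrite ler_wpM2l ?powR_ge0 // ler_powR | lra | lra].
apply: le_trans (H1 M M0) _; rewrite -mulrA ler_pM2l //.
apply: le_trans (_ : A `^ e1 * T1 + A `^ e2 * T2 <= _).
  by apply: lerD; apply: powM; rewrite /e1 /e2 //; lra.
have p1 := powR_ge0 A e1; have p2 := powR_ge0 A e2.
by rewrite mulrDl !mulrDr; nra.
Qed.
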